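(* For each $c\in\mathbb N$ consider the stationary queueing system at congestion level $c$ with congestion windows given by $G_i^{(c)}(k)=cG_i\big(\frac{k}{c}+\frac{d_i^{(c)}}{c}\big)$, $i\in\mathcal I$, and let $\bar M_i^{(c)}$ be the stationary number of route $i$ packets in the system. Let $$\Lambda_i^{(c)}=\mathbb E\Big[e^{G_i^{(c)}(\bar M_i^{(c)}+1)-G_i^{(c)}(\bar M_i^{(c)})}\Big],\qquad i\in\mathcal I,$$ be the stationary throughput of route $i$, i.e. the stationary rate at which packets are sent into the network by congestion window $i$ at congestion level $c$. Let $\Lambda^*=(\Lambda_i^*:i\in\mathcal I)$ be the optimal solution of the system problem $$\text{maximize } \sum_{i\in\mathcal I}U_i(\Lambda_i)\quad\text{subject to}\quad \sum_{i:\,j\in i}\Lambda_i\le C_j,\ j\in\mathcal J,\quad\text{over}\quad \Lambda_i\ge 0,\ i\in\mathcal I.$$ Then for every $i\in\mathcal I$, $$\Lambda_i^{(c)}\longrightarrow\Lambda_i^*\qquad\text{as } c\to\infty.$$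
   Context: **Network.** $\mathcal J$ is a finite set of queues. $\mathcal I$ is a finite set of routes, each route $i\in\mathcal I$ being a non-empty subset of $\mathcal J$ together with an ordering $(j_1^i,\dots,j_{k_i}^i)$ of its elements. $\mathcal K=\{(j,i)\in\mathcal J\times\mathcal I: j\in i\}$, $I=|\mathcal I|$, $K=|\mathcal K|$. Each queue $j$ has capacity $C_j\in(0,\infty)$. For each queue $j$ and $n\ge1$, $(\gamma_j(l,n))_{l=1}^n$ and $(\delta_j(l,n))_{l=1}^n$ are probability vectors (service proportions and insertion probabilities of positions). **Queueing system at congestion level $c$.** A state is $s=(s^j:j\in\mathcal J)$, where $s^j=(i^j_1,\dots,i^j_{m_j})$ is a finite word of routes $i\ni j$ (the routes of the packets in positions $1,\dots,m_j$ of queue $j$). Let $m_{ji}$ be the number of occurrences of $i$ in $s^j$, so $m_j=\sum_{i:j\in i}m_{ji}$, and let $\bar m_i=\sum_{j\in i}m_{ji}$ (the state of congestion window $i$). The system is the continuous-time Markov chain with the following transitions (rates of different events leading to the same state are added): - injection: for each route $i$, with $j=j_1^i$ and $l=1,\dots,m_j+1$, a route $i$ packet is inserted in position $l$ of queue $j$ (packets in positions $l,\dots,m_j$ move to $l+1,\dots,m_j+1$) at rate $g_i^{(c)}(\bar m_i)\,\delta_j(l,m_j+1)$; - transfer: if $i^j_l=i$, $j=j^i_k$, $j'=j^i_{k+1}$, $1\le k\le k_i-1$, the packet in position $l$ of queue $j$ leaves (packets in positions $l+1,\dots,m_j$ move to $l,\dots,m_j-1$) and is inserted in position $l'\in\{1,\dots,m_{j'}+1\}$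 of queue $j'$ at rate $C_j\gamma_j(l,m_j)\,\delta_{j'}(l',m_{j'}+1)$; - acknowledgement: if $i^j_l=i$ and $j=j^i_{k_i}$, the packet in position $l$ of queue $j$ leaves the system at rate $C_j\gamma_j(l,m_j)$. Here $g_i^{(c)}(k)=e^{G_i^{(c)}(k+1)-G_i^{(c)}(k)}$ for $k\in\mathbb Z_+$. Stationary means started from its stationary distribution; $M^{(c)}=(M^{(c)}_{ji}:(j,i)\in\mathcal K)$ denotes the vector of counts $m_{ji}$ under the stationary distribution, and $\bar M_i^{(c)}=\sum_{j\in i}M_{ji}^{(c)}$. **Utilities and congestion windows.** For each $i$, $U_i$ is an increasing, strictly concave, differentiable real function on $(0,\infty)$ with $U_i'(\Lambda)\to\infty$ as $\Lambda\to0$ (and $U_i(0)=\lim_{\Lambda\downarrow0}U_i(\Lambda)\in[-\infty,\infty)$). Define $G_i$ on $\mathbb R_+$ by $$-G_i(\bar m_i)=\sup_{\lambda_i\in\mathbb R}\{U_i(e^{\lambda_i})-\bar m_i\lambda_i\}.$$ Assumption 1: $\lambda\mapsto U_i(e^\lambda)$ is strictly concave on $\mathbb R$. Assumption 2: $G_i$ is strictly concave, continuously differentiable on $(0,\infty)$, with derivative taking all values in $\mathbb R$. (Equivalently to the definition of $G_i$, $U_i(e^{\lambda_i})=\min_{\bar m_i\in\mathbb R_+}\{\lambda_i\bar m_i-G_i(\bar m_i)\}$.) For each $i$, $(d_i^{(c)})_{c\in\mathbb N}$ is a bounded real sequence such that $G_i^{(c)}(k)=cG_i\big(\frac kc+\frac{d_i^{(c)}}c\big)$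 is defined and finite for all $k\in\mathbb Z_+$. *)

(* Defs.v *)
From HB Require Import structures.
From mathcomp Require Import all_boot all_order all_algebra.
From mathcomp Require Import all_classical all_reals all_analysis.
Import Order.TTheory GRing.Theory Num.Theory.
Import numFieldNormedType.Exports.

Set Implicit Arguments.
Unset Strict Implicit.
Unset Printing Implicit Defensive.

Local Open Scope classical_set_scope.
Local Open Scope ring_scope.

(* Queue and packet positions are numbered from 1: [gam j l n] and [del j l n]
   are only meaningful for 1 <= l <= n.  The order of the list [route i] is the
   order in which route i visits its queues. *)
Record network (R : realType) (J I : finType) := Network {
  route : I -> seq J;
  cap : J -> R;
  gam : J -> nat -> nat -> R;
  del : J -> nat -> nat -> R;
  route_neq0 : forall i, route i != [::];
  route_uniq : forall i, uniq (route i);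
  cap_gt0 : forall j, 0 < cap j;
  gam_ge0 : forall j l n, (1 <= l <= n)%N -> 0 <= gam j l n;
  gam_sum1 : forall j n, (1 <= n)%N -> \sum_(1 <= l < n.+1) gam j l n = 1;
  del_ge0 : forall j l n, (1 <= l <= n)%N -> 0 <= del j l n;
  del_sum1 : forall j n, (1 <= n)%N -> \sum_(1 <= l < n.+1) del j l n = 1
}.

Definition config (J I : finType) := {ffun J -> seq I}.

Definition state (R : realType) (J I : finType) (N : network R J I) :=
  {s : config J I | [forall j, all (fun i => j \in route N i) (s j)]}.

Definition insert_packet (J I : finType) (s : config J I) (j : J) (l : nat)
    (i : I) : config J I :=
  [ffun j' => if j' == j then take l.-1 (s j) ++ i :: drop l.-1 (s j)
              else s j'].

Definition remove_packet (J I : finType) (s : config J I) (j : J) (l : nat)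
    : config J I :=
  [ffun j' => if j' == j then take l.-1 (s j) ++ drop l (s j) else s j'].

Definition packet_at (J I : finType) (s : config J I) (j : J) (l : nat)
    : option I := onth (s j) l.-1.

Definition first_queue (R : realType) (J I : finType) (N : network R J I)
    (i : I) : option J := ohead (route N i).

(* [None] when j is the last queue of route i. *)
Definition next_queue (R : realType) (J I : finType) (N : network R J I)
    (i : I) (j : J) : option J :=
  onth (route N i) (index j (route N i)).+1.

Definition count_at (J I : finType) (s : config J I) (j : J) (i : I) : nat :=
  count_mem i (s j).

Definition window (R : realType) (J I : finType) (N : network R J I)
    (s : config J I) (i : I) : nat :=
  (\sum_(j in route N i) count_at s j i)%N.

Definition injection_rate (R : realType) (J I : finType) (N : network R J I)
    (g : I -> nat -> R) (s s' : config J I) : R :=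
  \sum_i \sum_(j | first_queue N i == Some j)
    \sum_(1 <= l < (size (s j)).+2 | insert_packet s j l i == s')
      g i (window N s i) * del N j l (size (s j)).+1.

Definition transfer_rate (R : realType) (J I : finType) (N : network R J I)
    (s s' : config J I) : R :=
  \sum_j \sum_(1 <= l < (size (s j)).+1)
    \sum_(i | packet_at s j l == Some i)
    \sum_(j' | next_queue N i j == Some j')
    \sum_(1 <= l' < (size (s j')).+2
           | insert_packet (remove_packet s j l) j' l' i == s')
      cap N j * gam N j l (size (s j)) * del N j' l' (size (s j')).+1.

Definition ack_rate (R : realType) (J I : finType) (N : network R J I)
    (s s' : config J I) : R :=
  \sum_j \sum_(1 <= l < (size (s j)).+1)
    \sum_(i | (packet_at s j l == Some i) && (next_queue N i j == None))
      if remove_packet s j l == s' then cap N j * gam N j l (size (s j)) else 0.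

Definition rate (R : realType) (J I : finType) (N : network R J I)
    (g : I -> nat -> R) (s s' : config J I) : R :=
  injection_rate N g s s' + transfer_rate N s s' + ack_rate N s s'.

(* A probability mass function p with p Q = 0, where Q is the generator with
   off-diagonal entries q; no event of the network maps a state to itself. *)
Definition stationary (R : realType) (T : choiceType) (q : T -> T -> R)
    (p : T -> R) : Prop :=
  [/\ forall s, 0 <= p s,
      \esum_(s in [set: T]) (p s)%:E = 1%E
    & forall s, \esum_(s' in [set~ s]) (p s' * q s' s)%:E
              = \esum_(s' in [set~ s]) (p s * q s s')%:E ].

Definition strictly_concave (R : realType) (D : set R) (f : R -> R) : Prop :=
  forall x y t : R, D x -> D y -> x != y -> 0 < t -> t < 1 ->
    t * f x + (1 - t) * f y < f (t * x + (1 - t) * y).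

Definition utility (R : realType) (U : R -> R) : Prop :=
  [/\ forall x y : R, 0 < x -> x < y -> U x < U y,
      strictly_concave [set x : R | 0 < x] U,
      forall x : R, 0 < x -> derivable U x 1
    & derive1 U x @[x --> 0^'+] --> +oo].

(* U is a function on (0, oo), extended to 0 by its possibly infinite limit. *)
Definition utility0 (R : realType) (U : R -> R) (x : R) : \bar R :=
  if 0 < x then (U x)%:E else lim ((U y)%:E @[y --> 0^'+]).

(* Takes values in [-oo, oo): the value at 0 is -oo when U is unbounded above. *)
Definition Gfun (R : realType) (U : R -> R) (m : R) : \bar R :=
  (- ereal_sup [set (U (expR lam) - m * lam)%:E | lam in [set: R]])%E.

Definition assumption1 (R : realType) (U : R -> R) : Prop :=
  strictly_concave [set: R] (fun lam => U (expR lam)).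

Definition assumption2 (R : realType) (U : R -> R) : Prop :=
  let G := fine \o Gfun U in
  [/\ forall m : R, 0 < m -> Gfun U m \is a fin_num,
      strictly_concave [set m : R | 0 < m] G,
      forall m : R, 0 < m -> derivable G m 1 /\ {for m, continuous (derive1 G)}
    & forall y : R, exists2 m : R, 0 < m & derive1 G m = y].

Definition scaled_arg (R : realType) (d : nat -> R) (c k : nat) : R :=
  k%:R / c%:R + d c / c%:R.

Definition Gc (R : realType) (U : R -> R) (d : nat -> R) (c k : nat) : R :=
  c%:R * fine (Gfun U (scaled_arg d c k)).

(* The domain of G is [0, oo). *)
Definition Gc_well_defined (R : realType) (U : R -> R) (d : nat -> R) : Prop :=
  forall c k, (0 < c)%N ->
    0 <= scaled_arg d c k /\ Gfun U (scaled_arg d c k) \is a fin_num.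

Definition gc (R : realType) (U : R -> R) (d : nat -> R) (c k : nat) : R :=
  expR (Gc U d c k.+1 - Gc U d c k).

Definition throughput (R : realType) (J I : finType) (N : network R J I)
    (g : I -> nat -> R) (p : state N -> R) (i : I) : \bar R :=
  \esum_(s in [set: state N]) (p s * g i (window N (val s) i))%:E.

Definition feasible (R : realType) (J I : finType) (N : network R J I)
    (L : I -> R) : Prop :=
  (forall i, 0 <= L i) /\
  (forall j, \sum_(i | j \in route N i) L i <= cap N j).

Definition system_optimal (R : realType) (J I : finType) (N : network R J I)
    (U : I -> R -> R) (L : I -> R) : Prop :=
  feasible N L /\
  forall L', feasible N L' ->
    (\sum_i utility0 (U i) (L' i) <= \sum_i utility0 (U i) (L i))%E.

(* Main.v *)
(* For each [c] the stationary law [P] is proportional to the product form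
   [weight], and all that is used of it is that inserting a route [i] packet
   anywhere in a queue [j] of route [i] multiplies [P] by [g i (window i) / cap j]
   ([insertion_law]).  Taking the insertion at the head of [j], the stationary
   throughputs satisfy the capacity constraints exactly, for each [c].  Summing
   over all positions, for any feasible [L],
     E (\sum_i window_i * (L_i / g_i (window_i - 1) - 1)) <= #|J|,
   also after truncation to bounded total population.  By conjugacy of [G_i]
   and [U_i], [window_i / c] is within O(1 / c) of [g_i * U_i' (g_i)], so after
   division by [c] the bound reads E (\sum_i U_i' (g_i) (L_i - g_i)) <= o(1).
   With [L] the optimum and the first-order condition
   \sum_i U_i' (L_i) (E g_i - L_i) <= 0, strict concavity forces g_i >= L_i - delta
   with probability tending to 1.  So the throughputs are asymptotically at
   least [L], and by the first-order condition again they cannot exceed it. *)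
Require Import Defs.
From mathcomp Require Import all_boot all_order all_algebra.
From mathcomp Require Import all_classical all_reals all_analysis.
From mathcomp Require Import ring lra zify.
Import Order.TTheory GRing.Theory Num.Theory.
Import numFieldNormedType.Exports.
Local Open Scope classical_set_scope.
Local Open Scope ring_scope.

Set Implicit Arguments.
Unset Strict Implicit.
Unset Printing Implicit Defensive.

(** * Sums over countable state spaces and uniqueness of balanced measures *)

Local Open Scope ereal_scope.

(** The stationary law is given only through its balance equations, so the product form has to come
    from a uniqueness argument. With bounded exit rates the minimum of two balanced measures, one of
    finite mass, is again balanced; together with reachability of the empty network this gives
    uniqueness. The mass of [weight] is never computed: proportionality to the given stationary law
    settles it. No moment of the population is known beforehand, and the bound to be proved has the
    mean population on both sides; truncation makes the subtraction legitimate. Used with the crude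
    estimate that [L_i / g_i] is at least 2 in large windows, the same inequality shows that the
    mean population is O(c). Hence, outside an event of small probability, windows stay below
    [B * c], where the rates are bounded away from 0 and the O(1 / c) errors are uniform. Capping
    the rates at [2 * L_i] keeps all functions bounded. The estimates are carried out at each large
    [c], without a limit of [M / c]. *)

Lemma le_esumZl (R : realType) (T : choiceType) (I : set T) (a : T -> \bar R)
    (k : R) : (0 <= k)%R -> (forall t, I t -> 0 <= a t) ->
  \esum_(t in I) (k%:E * a t) <= k%:E * \esum_(t in I) a t.
Proof.
move=> k0 a0; apply: ge_ereal_sup => _ [X [finX XI] <-].
rewrite fsbig_finite//= big_seq -ge0_sume_distrr; last first.
  by move=> t; rewrite in_fset_set// inE => /XI/a0.
rewrite -big_seq lee_wpmul2l ?lee_fin//; apply: esum_ge; exists X => //.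
by rewrite fsbig_finite.
Qed.

Lemma esumZl (R : realType) (T : choiceType) (I : set T) (a : T -> \bar R)
    (k : R) : (0 <= k)%R -> (forall t, I t -> 0 <= a t) ->
  \esum_(t in I) (k%:E * a t) = k%:E * \esum_(t in I) a t.
Proof.
move=> k0 a0; apply/eqP; rewrite eq_le le_esumZl//=.
have [->|kn0] := eqVneq k 0%R.
  by rewrite mul0e esum_ge0// => t _; rewrite mul0e.
have {kn0}k0 : (0 < k)%R by rewrite lt_neqAle eq_sym kn0.
have kV0 : (0 <= k^-1)%R by rewrite invr_ge0 ltW.
apply: (@le_trans _ _ (k%:E * (k^-1%:E * \esum_(t in I) (k%:E * a t)))).
  rewrite lee_wpmul2l ?lee_fin ?(ltW k0)//.
  apply: le_trans (le_esumZl kV0 _); last first.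
    by move=> t It; rewrite mule_ge0 ?a0// lee_fin ltW.
  by apply: le_esum => t It; rewrite muleA -EFinM mulVf ?gt_eqF// mul1e.
by rewrite muleA -EFinM divff ?gt_eqF// mul1e.
Qed.

Lemma esumC (R : realType) (T1 T2 : choiceType) (a : T1 -> T2 -> \bar R) :
  (forall i j, 0 <= a i j) ->
  \esum_(i in [set: T1]) \esum_(j in [set: T2]) a i j =
  \esum_(j in [set: T2]) \esum_(i in [set: T1]) a i j.
Proof.
move=> a0; rewrite !esum_esum//.
rewrite (reindex_esum ([set: T2] `*` [set: T1]) _ (fun x => (x.2, x.1)))//=.
by split=> //= [[i j] [k l] _ _ /= [-> ->]//|[i j] _]; exists (j, i).
Qed.

Lemma le_esum_term (R : realType) (T : choiceType) (a : T -> \bar R) t :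
  (forall s, 0 <= a s) -> a t <= \esum_(s in [set: T]) a s.
Proof.
move=> a0; rewrite -[leLHS](@esum_set1 _ _ t a)// esum_mkcond.
by apply: le_esum => s _; case: ifP.
Qed.

Lemma esum_pred1 (R : realType) (T : choiceType) (t : T) (a : T -> \bar R) :
  0 <= a t -> \esum_(s in [set: T]) (if t == s then a s else 0) = a t.
Proof.
move=> at0; rewrite -[RHS](@esum_set1 _ _ t a)// [RHS]esum_mkcond.
apply: eq_esum => s _; case: eqVneq => [->|ts]; first by rewrite mem_set.
by rewrite memNset//= => st; rewrite st eqxx in ts.
Qed.

(** The gaps [b - a] are nonnegative and, the sums being finite, have total at most 0. *)
Lemma esum_eq_of_le (R : realType) (T : choiceType) (a b : T -> \bar R) :
  (forall t, 0 <= a t <= b t) -> \esum_(t in [set: T]) b t < +oo ->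
  \esum_(t in [set: T]) b t <= \esum_(t in [set: T]) a t ->
  forall t, a t = b t.
Proof.
move=> ab boo ba t.
have a0 s : 0 <= a s by case/andP: (ab s).
have afin s : a s \is a fin_num.
  rewrite ge0_fin_numE// (le_lt_trans _ boo)//.
  case/andP: (ab s) => _ /le_trans; apply; apply: le_esum_term => u.
  by case/andP: (ab u) => ? /(le_trans _); apply.
have d0 s : 0 <= b s - a s by rewrite sube_ge0 ?afin//; case/andP: (ab s).
have E : \esum_(s in [set: T]) b s =
    \esum_(s in [set: T]) a s + \esum_(s in [set: T]) (b s - a s).
  by rewrite -esumD//; apply: eq_esum => s _; rewrite addeC subeK.
have sa0 : \esum_(s in [set: T]) a s \is a fin_num.
  rewrite ge0_fin_numE ?esum_ge0// (le_lt_trans _ boo)// le_esum// => s _.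
  by case/andP: (ab s).
have : \esum_(s in [set: T]) (b s - a s) <= 0.
  by move: ba; rewrite E -[leRHS]adde0 leeD2lE.
move=> /(le_trans (le_esum_term t d0)); rewrite sube_le0 => bat.
by apply/eqP; rewrite eq_le bat; case/andP: (ab t) => _ ->.
Qed.

Section balance.
Context (R : realType) (T : choiceType) (q : T -> T -> R) (Q : T -> R) (K : R).
Hypothesis q_ge0 : forall s t, (0 <= q s t)%R.
Hypothesis q_exit : forall s, \esum_(t in [set: T]) (q s t)%:E = (Q s)%:E.
Hypothesis Q_le : forall s, (Q s <= K)%R.

(** Global balance with whole row and column sums: a rate [q s s] counts on both sides, whereas
    [stationary] omits it from both. *)
Definition balanced (v : T -> R) :=
  forall s, \esum_(t in [set: T]) (v t * q t s)%:E = (v s * Q s)%:E.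

Lemma exit_rate_ge0 s : (0 <= Q s)%R.
Proof. by rewrite -lee_fin -q_exit esum_ge0// => t _; rewrite lee_fin. Qed.

(** A strong maximum principle: where [w <= v] touch, their inflows agree, and termwise comparison
    makes them touch at every predecessor. *)
Lemma balanced_eq_at (v w : T -> R) t :
  (forall s, 0 <= w s <= v s)%R -> balanced v -> balanced w ->
  w t = v t -> forall s, (0 < q s t)%R -> w s = v s.
Proof.
move=> wv bv bw wvt s qst.
suff /(_ s) [] : forall u, (w u * q u t)%:E = (v u * q u t)%:E.
  by move/mulIf; apply; rewrite gt_eqF.
apply: esum_eq_of_le => [u||]; last by rewrite bv bw wvt.
  case/andP: (wv u) => w0 wvu.
  by rewrite !lee_fin mulr_ge0//= ler_wpM2r.
by rewrite bv ltry.
Qed.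

(** At each state the inflow of the minimum is at most its outflow, by comparison with [u] or [v].
    Total inflow equals total outflow, which is finite since [Q <= K] and [u] has finite mass, so
    equality holds at each state. *)
Lemma balanced_min (u v : T -> R) :
  (forall s, 0 <= u s)%R -> (forall s, 0 <= v s)%R ->
  \esum_(s in [set: T]) (u s)%:E < +oo -> balanced u -> balanced v ->
  balanced (fun s => Num.min (u s) (v s)).
Proof.
move=> u0 v0 usum bu bv; set w := (fun s => _).
have w0 s : (0 <= w s)%R by rewrite /w le_min u0 v0.
have wu s : (w s <= u s)%R by rewrite /w ge_min lexx.
have wv s : (w s <= v s)%R by rewrite /w ge_min lexx orbT.
have K0 s : (0 <= K)%R := le_trans (exit_rate_ge0 s) (Q_le s).
apply: esum_eq_of_le => [s|| ].
- rewrite esum_ge0 => [|t _]; last by rewrite lee_fin mulr_ge0.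
  rewrite {2}/w; case: (leP (u s) (v s)) => _; [rewrite -bu|rewrite -bv].
  + by apply: le_esum => t _; rewrite lee_fin ler_wpM2r.
  + by apply: le_esum => t _; rewrite lee_fin ler_wpM2r.
- apply: (@le_lt_trans _ _ (\esum_(s in [set: T]) (`|K|%:E * (u s)%:E))).
    apply: le_esum => s _; rewrite -EFinM lee_fin mulrC ler_pM//.
      exact: exit_rate_ge0.
    exact: le_trans (Q_le s) (ler_norm _).
  rewrite esumZl// => [|s _]; last by rewrite lee_fin.
  by rewrite lte_mul_pinfty// lee_fin.
- rewrite esumC => [|s t]; last by rewrite lee_fin mulr_ge0.
  apply: le_esum => s _.
  under [leRHS]eq_esum do rewrite EFinM.
  rewrite esumZl// => [|t _]; last by rewrite lee_fin.
  by rewrite q_exit -EFinM.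
Qed.

(* For a balanced [u] of finite mass and a balanced [v], the sets
   [v <= a * u] and [a * u <= v] are closed under predecessors, because
   [min v (a * u)] is balanced too. *)
Lemma balanced_unique (u v : T -> R) (o : T) (reach : set T) :
  (forall s, 0 <= u s)%R -> (forall s, 0 <= v s)%R ->
  \esum_(s in [set: T]) (u s)%:E < +oo -> balanced u -> balanced v ->
  (forall A : set T, A o -> (forall s t, A t -> (0 < q s t)%R -> A s) ->
     reach `<=` A) ->
  (0 < u o)%R -> forall s, reach s -> v s = (v o / u o * u s)%R.
Proof.
move=> u0 v0 usum bu bv reachP uo s rs.
set a := (v o / u o)%R.
have a0 : (0 <= a)%R by rewrite divr_ge0.
pose au s := (a * u s)%R.
have au0 s' : (0 <= au s')%R by rewrite mulr_ge0.
have bau : balanced au.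
  move=> t; rewrite /au -mulrA EFinM -bu -esumZl => [||? _]//.
    by apply: eq_esum => s' _; rewrite -EFinM mulrA.
  by rewrite lee_fin mulr_ge0.
have aus : \esum_(s in [set: T]) (au s)%:E < +oo.
  under eq_esum do rewrite EFinM.
  rewrite esumZl// => [|t _]; last by rewrite lee_fin.
  by rewrite lte_mul_pinfty// lee_fin.
have bw := balanced_min au0 v0 aus bau bv.
apply: (reachP (fun s => v s = au s)) rs.
  by rewrite /au /a divfK ?gt_eqF.
move=> {}s t vt qst.
have H1 : Num.min (au s) (v s) = au s.
  apply: balanced_eq_at bau bw _ _ qst; last by rewrite /= vt minxx.
  by move=> s'; rewrite le_min au0 v0 ge_min lexx.
have H2 : Num.min (au s) (v s) = v s.
  apply: balanced_eq_at bv bw _ _ qst; last by rewrite /= vt minxx.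
  by move=> s'; rewrite le_min au0 v0 ge_min lexx orbT.
by rewrite -H1 -[LHS]H2.
Qed.

(** The zero measure is balanced and touches [u] wherever [u] vanishes, so the zeros of [u] are
    closed under predecessors; if [o] were one, [u] would vanish on [reach], hence everywhere. *)
Lemma balanced_gt0 (u : T -> R) (o : T) (reach : set T) :
  (forall s, 0 <= u s)%R -> balanced u ->
  (forall A : set T, A o -> (forall s t, A t -> (0 < q s t)%R -> A s) ->
     reach `<=` A) ->
  (forall s, u s != 0 -> reach s)%R -> (exists s, u s != 0)%R -> (0 < u o)%R.
Proof.
move=> u0 bu reachP ureach [s us0]; rewrite lt_neqAle u0 andbT eq_sym.
apply/eqP => uo; move/eqP: (us0); apply.
have /reachP : [set t | u t = 0%R] o by [].
apply; last exact: ureach.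
move=> {us0}s t /= ut qst.
have := @balanced_eq_at u (fun=> 0%R) t.
move=> /(_ _ bu _ _ s qst) <- //.
- by move=> s'; rewrite lexx u0.
- by move=> t'; rewrite mul0r esum1// => s' _; rewrite mul0r.
Qed.

End balance.
Local Close Scope ereal_scope.

(** * Inserting and removing packets *)

Section packets.
Context (J I : finType).
Implicit Types (s : config J I) (j : J) (i : I) (l : nat).

Lemma size_insert s j l i j' :
  size (insert_packet s j l i j') = (size (s j') + (j' == j))%N.
Proof.
rewrite ffunE; case: eqP => [->|_]; last by rewrite addn0.
by rewrite size_cat /= addnS -size_cat cat_take_drop addn1.
Qed.

Lemma size_remove s j l j' : (1 <= l <= size (s j))%N ->
  size (remove_packet s j l j') = (size (s j') - (j' == j))%N.
Proof.
case: l => // l /= lj; rewrite ffunE; case: eqP => [->|_]; last by rewrite subn0.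
by rewrite size_cat /= size_take lj size_drop; lia.
Qed.

Lemma remove_packet_neq s j l j' : j' != j -> remove_packet s j l j' = s j'.
Proof. by move=> jj'; rewrite ffunE (negPf jj'). Qed.

Lemma insert_packet_neq s j l i j' : j' != j -> insert_packet s j l i j' = s j'.
Proof. by move=> jj'; rewrite ffunE (negPf jj'). Qed.

Lemma packet_at_size s j l i :
  packet_at s j l = Some i -> (l.-1 < size (s j))%N.
Proof. by move=> sl; apply: contraPltn sl => sz; rewrite /packet_at onth_default. Qed.

Lemma packet_at_ex s j l : (1 <= l <= size (s j))%N ->
  exists i, packet_at s j l = Some i.
Proof.
case: l => // l /= lj; rewrite /packet_at /=.
have := onthTE (s j) l; rewrite lj.
by case: (onth _ _) => // i _; exists i.
Qed.

Lemma packet_at_insert s j l i : (1 <= l <= (size (s j)).+1)%N ->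
  packet_at (insert_packet s j l i) j l = Some i.
Proof.
case: l => // l /= lj; rewrite /packet_at ffunE eqxx /=.
by rewrite onth_cat size_takel// ltnn subnn.
Qed.

Lemma insertK s j l i : (1 <= l <= (size (s j)).+1)%N ->
  remove_packet (insert_packet s j l i) j l = s.
Proof.
case: l => // l lj; apply/ffunP => j'; rewrite ffunE; case: eqP => [->|].
  rewrite ffunE eqxx /= take_size_cat ?size_takel//.
  by rewrite -cat_rcons drop_size_cat ?cat_take_drop// size_rcons size_takel.
by move=> /eqP jj'; rewrite insert_packet_neq.
Qed.

Lemma removeK s j l i : (1 <= l)%N -> packet_at s j l = Some i ->
  insert_packet (remove_packet s j l) j l i = s.
Proof.
case: l => // l _ sl; apply/ffunP => j'; rewrite ffunE; case: eqP => [->|].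
  have /= lj := packet_at_size sl.
  rewrite ffunE eqxx /= take_size_cat ?size_takel ?(ltnW lj)//.
  rewrite drop_size_cat ?size_takel ?(ltnW lj)//.
  rewrite -[RHS](cat_take_drop l); congr (_ ++ _).
  rewrite (drop_nth i lj); congr (_ :: _).
  by rewrite (onth_nth i _ _ _ sl).
  
by move=> /eqP jj'; rewrite remove_packet_neq.
Qed.

Lemma count_at_insert s j l i j' i' : count_at (insert_packet s j l i) j' i' =
  (count_at s j' i' + (j' == j) * (i == i'))%N.
Proof.
rewrite /count_at ffunE; case: eqP => [->|_]; last by rewrite addn0.
by rewrite count_cat /= addnCA -count_cat cat_take_drop mul1n addnC.
Qed.

Lemma sum_packet_at (V : nmodType) s j (F : I -> V) :
  \sum_(1 <= l < (size (s j)).+1) \sum_(i | packet_at s j l == Some i) F i =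
  \sum_(i <- s j) F i.
Proof.
case E : (s j) => [|i0 s'] /=; first by rewrite big_geq// big_nil.
rewrite big_add1 [RHS](big_nth i0) !big_mkord; apply: eq_bigr => l _ /=.
rewrite (big_pred1 (nth i0 (i0 :: s') l))// => i /=.
rewrite /packet_at E [RHS]eq_sym onthE /= -map_cons (nth_map i0)//.
Qed.

Lemma sum_packet_at_const (V : nmodType) s j i (x : V) :
  \sum_(1 <= l < (size (s j)).+1 | packet_at s j l == Some i) x =
  x *+ count_at s j i.
Proof.
rewrite big_mkcond /=.
transitivity (\sum_(1 <= l < (size (s j)).+1)
    \sum_(i' | packet_at s j l == Some i') if i' == i then x else 0).
  rewrite !big_nat; apply: eq_bigr => l ll; have [i' ->] := packet_at_ex ll.
  by rewrite (big_pred1 i') => [|?]; rewrite (inj_eq Some_inj)// eq_sym.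
by rewrite sum_packet_at -big_mkcond big_const_seq iter_addr_0.
Qed.

End packets.

Lemma sum_nat_esum (R : realType) (F : nat -> \bar R) (m n : nat) (P : pred nat) :
  (forall l, (m <= l < n)%N -> P l -> (0 <= F l)%E) ->
  (\sum_(m <= l < n | P l) F l =
   \esum_(l in [set l | (m <= l < n)%N && P l]) F l)%E.
Proof.
move=> F0; rewrite -big_filter.
rewrite (_ : [set l | _] = [set` [seq l <- index_iota m n | P l]]); last first.
  by apply/seteqP; split => l /=; rewrite mem_filter mem_index_iota andbC.
rewrite esum_fset//; first last.
- by move=> l; rewrite inE /= mem_filter mem_index_iota => /andP[? ?]; exact: F0.
- exact: finite_seq.
by rewrite fsbig_seq// filter_uniq ?iota_uniq.
Qed.

(* Inserting at position [l] of queue [j] is a bijection from pairs (state,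
   insertion position) onto pairs (state, position of a route [i] packet). *)
Lemma esum_insert (R : realType) (J I : finType) (j : J) (i : I)
    (F : config J I -> nat -> \bar R) :
  (forall (s : config J I) l, (1 <= l <= size (s j))%N -> (0 <= F s l)%E) ->
  (\esum_(s in [set: config J I])
     \sum_(1 <= l < (size (s j)).+1 | packet_at s j l == Some i) F s l =
   \esum_(s in [set: config J I])
     \sum_(1 <= l < (size (s j)).+2) F (insert_packet s j l i) l)%E.
Proof.
move=> F0.
have F0' (s : config J I) l : (1 <= l < (size (s j)).+2)%N ->
    (0 <= F (insert_packet s j l i) l)%E.
  by move=> ll; apply: F0; rewrite size_insert eqxx addn1.
under eq_esum => s _ do (rewrite sum_nat_esum; last by move=> l ll _; exact: F0).
under [RHS]eq_esum => s _ do (rewrite sum_nat_esum; last by move=> l ll _; exact: F0').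
rewrite !esum_esum; first last.
- by move=> s l _ /= /andP[ll _]; exact: F0.
- by move=> s l _ /= /andP[ll _]; exact: F0'.
set A := (X in esum X); set B := (X in _ = esum X _).
rewrite (reindex_esum B A (fun x => (insert_packet x.1 j x.2 i, x.2)))//.
split.
- move=> [s l]; rewrite /A /B /= andbT => -[_ ll]; split => //.
  by rewrite packet_at_insert ?eqxx ?andbT// size_insert eqxx addn1.
- move=> [s l] [s' l']; rewrite !inE /B /= !andbT => -[_ ll] [_ ll'] [ss' e].
  rewrite -{}e in ll' ss' *; congr (_, _).
  by rewrite -[LHS](insertK i ll) ss' insertK.
- move=> [s l]; rewrite /A /B /= => -[_ /andP[ll /eqP sl]].
  exists (remove_packet s j l, l) => /=; last first.
    by rewrite (removeK _ sl)//; case/andP: ll.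
  by split => //; rewrite andbT size_remove// eqxx; lia.
Qed.

Lemma esum_sum_nat (R : realType) (T : choiceType) (A : set T) (m n : nat)
    (P : pred nat) (a : T -> nat -> \bar R) :
  (forall t l, A t -> (m <= l < n)%N -> P l -> (0 <= a t l)%E) ->
  (\esum_(t in A) \sum_(m <= l < n | P l) a t l =
   \sum_(m <= l < n | P l) \esum_(t in A) a t l)%E.
Proof.
move=> a0; under eq_esum do rewrite big_nat_cond.
by rewrite esum_sum -?big_nat_cond// => t l At /andP[]; exact: a0.
Qed.

Lemma big_Some (V : nmodType) (T : finType) (o : option T) (F : T -> V) :
  \sum_(t | o == Some t) F t = oapp F 0 o.
Proof.
case: o => [t|]; last by rewrite big_pred0.
by rewrite (big_pred1 t)// => u /=; rewrite eq_sym.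
Qed.

Lemma onth_index_succ_None (T : eqType) (r : seq T) (x : T) :
  x \notin r -> onth r (index x r).+1 = None.
Proof. by rewrite -index_mem -leqNgt => sz; rewrite onth_default// ltnW. Qed.

(** In a duplicate-free route every queue but the first is the successor of exactly one queue:
    injections feed the first queue, transfers each of the others. *)
Lemma sum_first_next (V : nmodType) (T : finType) (r : seq T) (F : T -> V) :
  uniq r ->
  oapp F 0 (ohead r) + \sum_x oapp F 0 (onth r (index x r).+1) =
  \sum_(x in r) F x.
Proof.
move=> ur.
have -> : \sum_x oapp F 0 (onth r (index x r).+1) =
    \sum_(x in r) oapp F 0 (onth r (index x r).+1).
  rewrite [RHS]big_mkcond; apply: eq_bigr => x _.
  by case: ifPn => // xr; rewrite onth_index_succ_None.
rewrite -!big_uniq//; case: r ur => [_|x0 r' ur]; first by rewrite !big_nil addr0.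
rewrite [RHS]big_cons /= (big_nth x0) [in RHS](big_nth x0) /= big_nat_recr//=.
rewrite [X in _ + (_ + X)](_ : _ = 0) ?addr0; last first.
  have := index_uniq x0 (ltnSn _ : (size r' < size (x0 :: r'))%N) ur; rewrite /= => ->.
  by rewrite onth_default.
congr (_ + _); rewrite !big_nat; apply: eq_bigr => k /= kr.
have := index_uniq x0 (ltnW kr : (k < size (x0 :: r'))%N) ur; rewrite /= => ->.
by rewrite -(odflt_onth x0); have := onthTE r' k; rewrite kr; case: onth.
Qed.

Lemma sum_last (V : nmodType) (T : finType) (r : seq T) (y : V) :
  uniq r -> r != [::] ->
  \sum_(x in r | onth r (index x r).+1 == None) y = y.
Proof.
move=> ur r0; have [x0 xr0] : exists x, x \in r.
  by case: r {ur} r0 => // x r' _; exists x; rewrite mem_head.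
have r_gt0 : (0 < size r)%N by case: r {ur xr0} r0.
have szr : ((size r).-1 < size r)%N by rewrite prednK.
transitivity (\sum_(x | x == nth x0 r (size r).-1) y); last exact: big_pred1_eq.
apply: eq_bigl => x; apply/andP/eqP => [[xr /eqP xN]|->]; last first.
  split; first by rewrite mem_nth.
  by rewrite index_uniq// prednK// onth_default.
rewrite -[LHS](nth_index x0 xr); congr nth.
have : (index x r < size r)%N by rewrite index_mem.
have := onthNE r (index x r).+1; rewrite xN /=; lia.
Qed.

(** * Product form *)

Section rates.
Context (R : realType) (J I : finType) (N : network R J I).
Variable g : I -> nat -> R.
Hypothesis g_gt0 : forall i k, 0 < g i k.
Implicit Types (s t : config J I) (j : J) (i : I) (l : nat).

Definition valid s := [forall j, all (fun i => j \in route N i) (s j)].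

Lemma valid_insert s j l i : j \in route N i ->
  valid (insert_packet s j l i) = valid s.
Proof.
move=> ji; apply: eq_forallb => j'; rewrite ffunE; case: eqP => [->|//].
by rewrite all_cat /= ji andTb -all_cat cat_take_drop.
Qed.

Lemma window_insert s j l i i' : j \in route N i' ->
  window N (insert_packet s j l i) i' = (window N s i' + (i == i'))%N.
Proof.
move=> ji'; rewrite /window.
under eq_bigr do rewrite count_at_insert.
rewrite big_split /=; congr (_ + _)%N.
rewrite (bigD1 j)//= eqxx mul1n big1 ?addn0// => j' /andP[_ /negPf ->].
by rewrite mul0n.
Qed.

Lemma window_insert_notin s j l i i' : i != i' ->
  window N (insert_packet s j l i) i' = window N s i'.
Proof.
move=> ii'; apply: eq_bigr => j' _; rewrite count_at_insert (negPf ii').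
by rewrite muln0 addn0.
Qed.

Lemma count_at_notin s j i : valid s -> j \notin route N i ->
  count_at s j i = 0%N.
Proof.
move=> /forallP /(_ j) /allP sj ji; apply/count_memPn.
by apply: contra ji => /sj.
Qed.

Definition exit_rate s : R :=
  \sum_i g i (window N s i) + \sum_j (s j != [::])%:R * cap N j.

Definition insertion_law (P : config J I -> R) := forall s j l i,
  j \in route N i ->
  P (insert_packet s j l i) = P s * g i (window N s i) / cap N j.

(** For [g = gc] the inner product telescopes to the exponential of the increment of [Gc] from 0 to
    the window. The indicator removes configurations with a packet off its route. *)
Definition weight s : R :=
  (valid s)%:R * (\prod_i \prod_(0 <= k < window N s i) g i k) *
  \prod_j (cap N j) ^- size (s j).

Lemma weight_ge0 s : 0 <= weight s.
Proof.
rewrite !mulr_ge0//.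
  by apply: prodr_ge0 => i _; apply: prodr_ge0 => k _; exact: ltW.
by apply: prodr_ge0 => j _; rewrite invr_ge0 exprn_ge0// ltW// cap_gt0.
Qed.

Lemma weight_insertion_law : insertion_law weight.
Proof.
move=> s j l i ji; rewrite /weight valid_insert//.
rewrite [X in _ * X * _](_ : _ = g i (window N s i) *
    \prod_i \prod_(0 <= k < window N s i) g i k); last first.
  rewrite (bigD1 i)//= window_insert// eqxx addn1 big_nat_recr//=.
  rewrite [in RHS](bigD1 i)//= mulrCA -!mulrA; congr (_ * (_ * _)).
  by apply: eq_bigr => i' i'i; rewrite window_insert_notin// eq_sym.
rewrite [X in _ * X](_ : _ = (cap N j)^-1 *
    \prod_j (cap N j) ^- size (s j)); last first.
  rewrite (bigD1 j)//= size_insert eqxx addn1 exprS invfM [in RHS](bigD1 j)//=.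
  rewrite -mulrA; congr (_ * (_ * _)).
  by apply: eq_bigr => j' /negPf j'j; rewrite size_insert j'j addn0.
by ring.
Qed.

Lemma size_sum_count s j : size (s j) = (\sum_i count_at s j i)%N.
Proof.
rewrite /count_at; elim: (s j) => [|i0 r IHr] /=; first by rewrite big1.
rewrite big_split /= -IHr (bigD1 i0)//= eqxx big1 ?addn0// => i /negPf.
by rewrite eq_sym => ->.
Qed.

Local Open Scope ereal_scope.

Lemma del_ge0E j l n (x : R) : (1 <= l < n.+1)%N -> (0 <= x)%R ->
  0 <= (x * del N j l n)%:E.
Proof. by move=> ln x0; rewrite lee_fin mulr_ge0// del_ge0. Qed.

(** [t] receives the packet and [s] fixes the number of positions; they differ for a transfer, where
    [t] is [s] without the moving packet. *)
Lemma esum_injections s t j i (x : R) : (0 <= x)%R ->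
  \esum_(s' in [set: config J I])
    (\sum_(1 <= l < (size (s j)).+2 | insert_packet t j l i == s')
      x * del N j l (size (s j)).+1)%:E = x%:E.
Proof.
move=> x0; under eq_esum do rewrite -sumEFin big_mkcond.
rewrite esum_sum_nat => [|s' l _ ll _]; last by case: ifP => // _; exact: del_ge0E.
rewrite (eq_big_nat _ _ (F2 := fun l => (x * del N j l (size (s j)).+1)%:E)).
  by rewrite sumEFin -mulr_sumr del_sum1// mulr1.
by move=> l ll; rewrite (esum_pred1 (a := fun=> _))//; exact: del_ge0E.
Qed.

Lemma injections_ge0 s t s' j i (x : R) : (0 <= x)%R ->
  (0 <= \sum_(1 <= l < (size (s j)).+2 | insert_packet t j l i == s')
      x * del N j l (size (s j)).+1)%R.
Proof.
move=> x0; rewrite big_nat_cond sumr_ge0// => l /andP[ll _].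
by rewrite mulr_ge0// del_ge0.
Qed.

Lemma first_queue_ex i : exists2 j, first_queue N i = Some j & j \in route N i.
Proof.
rewrite /first_queue; have := route_neq0 N i.
by case: (route N i) => // j r _; exists j => //; rewrite mem_head.
Qed.

Lemma injection_exit s :
  \esum_(s' in [set: config J I]) (injection_rate N g s s')%:E =
  (\sum_i g i (window N s i))%:E.
Proof.
rewrite /injection_rate; under eq_esum do rewrite -sumEFin.
have [f fE] := choice (fun i => ex_intro (fun j => first_queue N i = Some j)
  (s2val (cid2 (first_queue_ex i))) (s2valP (cid2 (first_queue_ex i)))).
under eq_esum do (under eq_bigr do rewrite fE big_Some /=).
rewrite esum_sum => [|s' i _ _]; last by rewrite lee_fin injections_ge0// ltW.
by rewrite -sumEFin; apply: eq_bigr => i _; rewrite esum_injections// ltW.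
Qed.

(** Transfers and acknowledgements in one expression: without a next queue, [oapp] falls back to
    leaving the network. *)
Definition move_rate s s' j l i : R :=
  (let x := cap N j * gam N j l (size (s j)) in
  let t := remove_packet s j l in
  oapp (fun j' => \sum_(1 <= l' < (size (s j')).+2 | insert_packet t j' l' i == s')
                    x * del N j' l' (size (s j')).+1)
       (if t == s' then x else 0) (next_queue N i j))%R.

Lemma service_rateE s s' : (transfer_rate N s s' + ack_rate N s s' =
  \sum_j \sum_(1 <= l < (size (s j)).+1) \sum_(i | packet_at s j l == Some i)
    move_rate s s' j l i)%R.
Proof.
rewrite -big_split; apply: eq_bigr => j _; rewrite -big_split.
apply: eq_bigr => l _ /=; rewrite [X in (_ + X)%R]big_mkcondr -big_split /=.
apply: eq_bigr => i _; rewrite big_Some /move_rate.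
by case: (next_queue N i j) => [j'|] /=; rewrite ?addr0 ?add0r.
Qed.

Lemma cap_gam_ge0 s j l : (1 <= l < (size (s j)).+1)%N ->
  (0 <= cap N j * gam N j l (size (s j)))%R.
Proof. by move=> ll; rewrite mulr_ge0 ?gam_ge0// ltW// cap_gt0. Qed.

Lemma move_rate_ge0 s s' j l i : (1 <= l < (size (s j)).+1)%N ->
  (0 <= move_rate s s' j l i)%R.
Proof.
move=> ll; rewrite /move_rate; case: next_queue => [j'|] /=.
  by rewrite injections_ge0// cap_gam_ge0.
by case: ifP => // _; rewrite cap_gam_ge0.
Qed.

Lemma esum_move s j l i : (1 <= l < (size (s j)).+1)%N ->
  \esum_(s' in [set: config J I]) (move_rate s s' j l i)%:E =
  (cap N j * gam N j l (size (s j)))%:E.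
Proof.
move=> ll; rewrite /move_rate; case: next_queue => [j'|] /=.
  by rewrite esum_injections// cap_gam_ge0.
under eq_esum do rewrite (fun_if EFin).
by rewrite (esum_pred1 (a := fun=> _))// lee_fin cap_gam_ge0.
Qed.

Lemma injection_rate_ge0 s s' : (0 <= injection_rate N g s s')%R.
Proof.
apply: sumr_ge0 => i _; rewrite big_Some; case: first_queue => //= j.
by rewrite injections_ge0// ltW.
Qed.

Lemma service_rate_ge0 s s' : (0 <= transfer_rate N s s' + ack_rate N s s')%R.
Proof.
rewrite service_rateE; apply: sumr_ge0 => j _; rewrite big_nat sumr_ge0// => l ll.
by apply: sumr_ge0 => i _; rewrite move_rate_ge0.
Qed.

Lemma rate_ge0 s s' : (0 <= rate N g s s')%R.
Proof. by rewrite /rate -addrA addr_ge0 ?injection_rate_ge0 ?service_rate_ge0. Qed.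

Lemma sum_gam s j (x : R) :
  (\sum_(1 <= l < (size (s j)).+1) x * gam N j l (size (s j)) =
   (s j != [::])%:R * x)%R.
Proof.
case: eqVneq => [->|sj]; first by rewrite /= big_geq// mul0r.
by rewrite -mulr_sumr gam_sum1 ?mulr1 ?mul1r// lt0n size_eq0.
Qed.

Lemma service_exit s :
  \esum_(s' in [set: config J I]) (transfer_rate N s s' + ack_rate N s s')%:E =
  (\sum_j (s j != [::])%:R * cap N j)%:E.
Proof.
under eq_esum do rewrite service_rateE -sumEFin.
rewrite esum_sum => [|s' j _ _]; last first.
  rewrite lee_fin big_nat sumr_ge0// => l ll.
  by apply: sumr_ge0 => i _; rewrite move_rate_ge0.
rewrite -sumEFin; apply: eq_bigr => j _; rewrite -sum_gam.
under eq_esum do rewrite -sumEFin.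
rewrite esum_sum_nat => [|s' l _ ll _]; last first.
  by rewrite lee_fin; apply: sumr_ge0 => i _; rewrite move_rate_ge0.
rewrite -sumEFin !big_nat; apply: eq_bigr => l ll.
have [i ->] := packet_at_ex ll.
by under eq_esum do rewrite big_Some /=; rewrite esum_move.
Qed.

Lemma rate_exit s :
  \esum_(s' in [set: config J I]) (rate N g s s')%:E = (exit_rate s)%:E.
Proof.
rewrite /rate; under eq_esum do rewrite -addrA EFinD.
rewrite esumD ?injection_exit ?service_exit// => s' _; rewrite lee_fin.
  exact: injection_rate_ge0.
exact: service_rate_ge0.
Qed.

Section inflow.
Variable P : config J I -> R.
Hypothesis P_ge0 : forall s, (0 <= P s)%R.
Hypothesis P_law : insertion_law P.
Hypothesis P_valid : forall s, ~~ valid s -> P s = 0%R.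

(** The service rate of route [i] packets at [j] in the time-reversed system, where [del] takes the
    part of [gam]. *)
Definition insert_share s j i : R :=
  (\sum_(1 <= l < (size (s j)).+1 | packet_at s j l == Some i)
    cap N j * del N j l (size (s j)))%R.

(** [insertion_law] turns [P t * g] into [cap * P] of the state after insertion; [esum_insert] then
    re-indexes the insertions ending in [s] by the positions of [s] that hold a route [i] packet. *)
Lemma inflow_insert s j i : j \in route N i ->
  \esum_(t in [set: config J I])
    (\sum_(1 <= l < (size (t j)).+2 | insert_packet t j l i == s)
      P t * g i (window N t i) * del N j l (size (t j)).+1)%:E =
  (P s * insert_share s j i)%:E.
Proof.
move=> ji; have C0 : cap N j != 0%R by rewrite gt_eqF// cap_gt0.
pose F t l := if s == t then (P t * (cap N j * del N j l (size (t j))))%:E else 0.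
transitivity (\esum_(t in [set: config J I])
    \sum_(1 <= l < (size (t j)).+2) F (insert_packet t j l i) l).
  apply: eq_esum => t _; rewrite -sumEFin big_mkcond; apply: eq_bigr => l _.
  rewrite /F eq_sym; case: eqP => // _; rewrite P_law// size_insert eqxx addn1.
  by congr EFin; field.
rewrite -esum_insert; last first.
  move=> t l ll; rewrite /F; case: eqP => // _.
  by rewrite lee_fin !mulr_ge0 ?del_ge0// ltW// cap_gt0.
rewrite (eq_esum (b := fun t => if s == t then
    (P t * insert_share t j i)%:E else 0)) => [|t _]; last first.
  rewrite /F; case: eqP => _; last by rewrite big1.
  by rewrite sumEFin mulr_sumr.
rewrite (esum_pred1 (a := fun t => (P t * insert_share t j i)%:E))//.
rewrite lee_fin mulr_ge0// /insert_share big_nat_cond sumr_ge0// => l /andP[ll _].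
by rewrite mulr_ge0 ?del_ge0// ltW// cap_gt0.
Qed.

Lemma inflow_injection s :
  \esum_(t in [set: config J I]) (P t * injection_rate N g t s)%:E =
  (P s * \sum_i oapp (insert_share s ^~ i) 0 (first_queue N i))%:E.
Proof.
rewrite mulr_sumr -sumEFin.
under eq_esum do rewrite /injection_rate mulr_sumr -sumEFin.
rewrite esum_sum => [|t i _ _]; last first.
  rewrite lee_fin mulr_ge0// big_Some; case: first_queue => //= j.
  by rewrite injections_ge0// ltW.
apply: eq_bigr => i _; have [j fj ji] := first_queue_ex i; rewrite fj /=.
rewrite -inflow_insert//; apply: eq_esum => t _; rewrite big_Some /= mulr_sumr.
by congr EFin; apply: eq_bigr => l _; rewrite mulrA.
Qed.

Lemma next_queue_route i j j' : next_queue N i j = Some j' ->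
  [/\ j \in route N i, j' \in route N i & j' != j].
Proof.
rewrite /next_queue => H.
have ji : j \in route N i.
  by apply: contraPT H => /onth_index_succ_None ->.
split => //; first by apply/onthP; exists (index j (route N i)).+1.
apply/eqP => jj'; have := onth_nth j _ _ _ H; rewrite jj' => H'.
have : ((index j (route N i)).+1 < size (route N i))%N.
  by have := onthTE (route N i) (index j (route N i)).+1; rewrite H.
move=> sz; have := index_uniq j sz (route_uniq N i); rewrite H'; lia.
Qed.

(** Write the source state as [t] with a packet inserted in position [l] of [j]. The law cancels
    [cap N j] and leaves [P t * g * gam], and [gam] sums to 1 over [l]. Departures from [j] thus
    enter the next queue like fresh arrivals into [t] at rate [g], or, from the last queue,
    contribute [P s * g]. *)
Lemma inflow_move s j i :
  \esum_(t in [set: config J I])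
    (\sum_(1 <= l < (size (t j)).+1 | packet_at t j l == Some i)
      P t * move_rate t s j l i)%:E =
  (P s * oapp (insert_share s ^~ i)
    ((j \in route N i)%:R * g i (window N s i)) (next_queue N i j))%:E.
Proof.
have C0 : cap N j != 0%R by rewrite gt_eqF// cap_gt0.
under eq_esum do rewrite -sumEFin.
have F0 t l : (1 <= l <= size (t j))%N -> 0 <= (P t * move_rate t s j l i)%:E.
  by move=> ll; rewrite lee_fin mulr_ge0// move_rate_ge0.
rewrite (esum_insert _ F0).
have [ji|ji] := boolP (j \in route N i); last first.
  rewrite /next_queue onth_index_succ_None//= mul0r mulr0.
  rewrite esum1// => t _; rewrite big1// => l _.
  rewrite P_valid ?mul0r//; apply/forallP => /(_ j).
  by rewrite ffunE eqxx all_cat /= (negPf ji) /= andbF.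
under eq_esum do under eq_bigr do rewrite P_law//.
case E : (next_queue N i j) => [j'|]; rewrite /move_rate E /=.
  have [_ j'i j'j] := next_queue_route E.
  rewrite -inflow_insert//; apply: eq_esum => t _.
  transitivity (\sum_(1 <= l < (size (t j)).+2)
     ((\sum_(1 <= l' < (size (t j')).+2 | insert_packet t j' l' i == s)
      P t * g i (window N t i) * del N j' l' (size (t j')).+1) *
      gam N j l (size (t j)).+1)%:E).
    rewrite !big_nat; apply: eq_bigr => l ll.
    rewrite insertK// !size_insert eqxx (negPf j'j) addn0 addn1.
    congr EFin; rewrite mulr_sumr mulr_suml; apply: eq_bigr => l' _.
    by field.
  rewrite sumEFin; under eq_bigr do rewrite mulrC.
  by rewrite -mulr_suml gam_sum1// mul1r.
rewrite mul1r (eq_esum (b := fun t => if s == t then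
  (P t * g i (window N t i))%:E else 0)) => [|t _].
  rewrite (esum_pred1 (a := fun t => (P t * g i (window N t i))%:E))//.
  by rewrite lee_fin mulr_ge0// ltW.
rewrite big_nat (eq_bigr (fun l => if s == t then
    (P t * g i (window N t i) * gam N j l (size (t j)).+1)%:E else 0)); last first.
  move=> l ll; rewrite insertK// size_insert eqxx addn1 eq_sym.
  by case: eqP => _; rewrite ?mulr0//; congr EFin; field.
rewrite -big_nat; case: eqP => _; last by rewrite big1.
by rewrite sumEFin -mulr_sumr gam_sum1// mulr1.
Qed.

Lemma inflow_service s :
  \esum_(t in [set: config J I])
    (P t * (transfer_rate N t s + ack_rate N t s))%:E =
  (P s * \sum_i \sum_j oapp (insert_share s ^~ i)
    ((j \in route N i)%:R * g i (window N s i)) (next_queue N i j))%:E.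
Proof.
rewrite exchange_big mulr_sumr -sumEFin.
under eq_esum do rewrite service_rateE mulr_sumr -sumEFin.
rewrite esum_sum => [|t j _ _]; last first.
  rewrite lee_fin mulr_ge0// big_nat sumr_ge0// => l ll.
  by apply: sumr_ge0 => i _; rewrite move_rate_ge0.
apply: eq_bigr => j _; rewrite mulr_sumr -sumEFin.
under [RHS]eq_bigr do rewrite -inflow_move.
rewrite -esum_sum => [|t i _ _]; last first.
  rewrite lee_fin big_nat_cond sumr_ge0// => l /andP[ll _].
  by rewrite mulr_ge0// move_rate_ge0.
apply: eq_esum => t _; rewrite sumEFin; congr EFin; rewrite mulr_sumr.
under [RHS]eq_bigr do rewrite big_mkcond.
rewrite [RHS]exchange_big /=; apply: eq_bigr => l _.
by rewrite -big_mkcond mulr_sumr.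
Qed.

Lemma sum_insert_share s : P s != 0%R ->
  (\sum_i \sum_(j in route N i) insert_share s j i =
   \sum_j (s j != [::])%:R * cap N j)%R.
Proof.
move=> Ps; have sv : valid s by apply: contraNT Ps => /P_valid ->.
transitivity (\sum_i \sum_j insert_share s j i)%R.
  apply: eq_bigr => i _; rewrite [LHS]big_mkcond; apply: eq_bigr => j _.
  case: ifPn => // ji; rewrite /insert_share big1// => l /eqP sl.
  move/forallP: sv => /(_ j) /allP /(_ i).
  rewrite (negPf ji) => H; suff : false by []; apply: H.
  by apply/onthP; exists l.-1.
rewrite exchange_big; apply: eq_bigr => j _.
transitivity (\sum_(1 <= l < (size (s j)).+1) cap N j * del N j l (size (s j)))%R.
  under eq_bigr do rewrite /insert_share big_mkcond.
  rewrite exchange_big !big_nat; apply: eq_bigr => l ll /=.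
  by rewrite -big_mkcond; have [i ->] := packet_at_ex ll; rewrite big_Some.
case: eqVneq => [->|sj]; first by rewrite /= big_geq// mul0r.
by rewrite -mulr_sumr del_sum1 ?mulr1 ?mul1r// lt0n size_eq0.
Qed.

(** Balance holds in two parts: arrivals at queues bring in as much as services take out
    ([sum_insert_share]), and acknowledgements of route [i] bring in as much as its injections take
    out. *)
Lemma insertion_law_balanced : balanced (rate N g) exit_rate P.
Proof.
move=> s; under eq_esum do rewrite /rate -addrA mulrDr EFinD.
rewrite esumD; first last.
- by move=> t _; rewrite lee_fin mulr_ge0// service_rate_ge0.
- by move=> t _; rewrite lee_fin mulr_ge0// injection_rate_ge0.
rewrite inflow_injection inflow_service -EFinD -mulrDr; congr EFin.
have [->|Ps] := eqVneq (P s) 0%R; first by rewrite !mul0r.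
rewrite /exit_rate -sum_insert_share// -!big_split /=; congr (_ * _)%R.
apply: eq_bigr => i _; rewrite -sum_first_next ?route_uniq//.
rewrite -[g i _ in RHS](sum_last _ (route_uniq N i) (route_neq0 N i)).
rewrite [in RHS]addrC -addrA; congr (_ + _)%R.
rewrite [X in (_ + X)%R]big_mkcond -big_split; apply: eq_bigr => j _.
rewrite -/(next_queue N i j).
by case: next_queue => [j'|]; case: (j \in _); rewrite /= ?addr0 ?add0r ?mul1r ?mul0r.
Qed.

End inflow.

End rates.

(** * Reaching the empty network and identifying the stationary law *)

Lemma esum_setD1 (R : realType) (T : choiceType) (t : T) (a : T -> \bar R) :
  (forall s, 0 <= a s)%E ->
  (\esum_(s in [set: T]) a s = a t + \esum_(s in [set~ t]) a s)%E.
Proof.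
by move=> a0; rewrite (esumID [set t])// !setTI esum_set1.
Qed.

Lemma psumr_nat_gt0P (R : realType) (m n : nat) (P : pred nat) (F : nat -> R) :
  (forall l, (m <= l < n)%N -> P l -> 0 <= F l) ->
  (0 < \sum_(m <= l < n | P l) F l) <->
  exists l, [/\ (m <= l < n)%N, P l & 0 < F l].
Proof.
move=> F0; rewrite big_nat_cond lt_def sumr_ge0 ?andbT => [|l /andP[]]; last exact: F0.
rewrite psumr_neq0 => [|l /andP[]]; last exact: F0.
split => [/hasP[l _ /andP[/andP[? ?] ?]]|[l [ll Pl Fl]]]; first by exists l.
by apply/hasP; exists l; rewrite ?mem_index_iota// ll Pl.
Qed.

Lemma psumr_gt0 (R : realType) (T : finType) (P : pred T) (F : T -> R) t :
  (forall u, P u -> 0 <= F u) -> P t -> 0 < F t -> 0 < \sum_(u | P u) F u.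
Proof.
move=> F0 Pt Ft; rewrite lt_def sumr_ge0// andbT psumr_neq0//.
by apply/hasP; exists t; rewrite ?mem_index_enum// Pt.
Qed.

Section reachability.
Context (R : realType) (J I : finType) (N : network R J I).
Variable g : I -> nat -> R.
Hypothesis g_gt0 : forall i k, 0 < g i k.
Implicit Types (s t : config J I) (j : J) (i : I) (l : nat).

Definition empty_config : config J I := [ffun=> [::]].

Definition hops_left i j := (size (route N i) - index j (route N i))%N.

(** On valid configurations every service lowers this by 1, so services alone empty the network. *)
Definition workload s := (\sum_j \sum_(i <- s j) hops_left i j)%N.

Lemma workload_insert s j l i :
  workload (insert_packet s j l i) = (workload s + hops_left i j)%N.
Proof.
rewrite /workload (bigD1 j)//= [in RHS](bigD1 j)//= addnAC; congr (_ + _)%N.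
  rewrite ffunE eqxx big_cat /= big_cons addnCA -big_cat cat_take_drop.
  by rewrite addnC.
by apply: eq_bigr => j' j'j; rewrite insert_packet_neq.
Qed.

Lemma rate_gt0 s t j l i : (1 <= l < (size (s j)).+1)%N ->
  packet_at s j l = Some i -> 0 < move_rate N s t j l i -> 0 < rate N g s t.
Proof.
move=> ll sl m0; rewrite /rate -addrA ltr_wpDl ?injection_rate_ge0//.
rewrite service_rateE; apply: (@psumr_gt0 _ _ _ _ j) => //.
  move=> j' _; rewrite big_nat sumr_ge0// => l' ll'.
  by apply: sumr_ge0 => i' _; rewrite move_rate_ge0.
apply/psumr_nat_gt0P => [l' ll' _|].
  by apply: sumr_ge0 => i' _; rewrite move_rate_ge0.
by exists l; rewrite ll; split => //; rewrite sl big_Some.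
Qed.

(** Individual values of [gam] and [del] may vanish, but each family sums to 1, so some position is
    served, and some insertion position used, at a positive rate. *)
Lemma valid_succ s : valid N s -> s != empty_config ->
  exists t, [/\ valid N t, (workload t < workload s)%N & 0 < rate N g s t].
Proof.
move=> sv s0.
have [j sj] : exists j, s j != [::].
  apply/existsP; apply: contraNT s0 => /existsPn s0; apply/eqP/ffunP => j.
  by rewrite ffunE; apply/eqP; have := s0 j; rewrite negbK.
have sj0 : (0 < size (s j))%N by rewrite lt0n size_eq0.
have /psumr_nat_gt0P[|l [ll _ gl]] :
    0 < \sum_(1 <= l < (size (s j)).+1) gam N j l (size (s j)).
- by rewrite gam_sum1.
- by move=> l ll _; exact: gam_ge0.
have [i sl] := packet_at_ex ll.
have /allP/(_ i) ji := forallP sv j.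
have {}ji : j \in route N i by apply: ji; apply/onthP; exists l.-1.
have l1 : (1 <= l)%N by case/andP: ll.
set u := remove_packet s j l.
have uv : valid N u by rewrite -(valid_insert u l ji) removeK.
have su : workload s = (workload u + hops_left i j)%N.
  by rewrite -(workload_insert _ _ l) removeK.
have ij : (index j (route N i) < size (route N i))%N by rewrite index_mem.
have C0 := cap_gt0 N j.
case E : (next_queue N i j) => [j'|].
  have [_ j'i j'j] := next_queue_route E.
  have /psumr_nat_gt0P[|l' [ll' _ dl]] :
      0 < \sum_(1 <= l' < (size (s j')).+2) del N j' l' (size (s j')).+1.
  - by rewrite del_sum1.
  - by move=> l' ll' _; exact: del_ge0.
  exists (insert_packet u j' l' i); split; first by rewrite valid_insert.
    rewrite workload_insert su ltn_add2l /hops_left.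
    move: E; rewrite /next_queue => E.
    have sz : ((index j (route N i)).+1 < size (route N i))%N.
      by have := onthTE (route N i) (index j (route N i)).+1; rewrite E.
    rewrite -(onth_nth j _ _ _ E) index_uniq// ?route_uniq//; lia.
  apply: (rate_gt0 ll sl); rewrite /move_rate E /=.
  apply/psumr_nat_gt0P => [l'' ll'' _|].
    by rewrite mulr_ge0 ?cap_gam_ge0// del_ge0.
  by exists l'; rewrite ll' eqxx; split => //; rewrite !mulr_gt0.
exists u; split => //; first by rewrite su /hops_left; lia.
by apply: (rate_gt0 ll sl); rewrite /move_rate E /= eqxx mulr_gt0.
Qed.

Lemma valid_reach (A : set (config J I)) : A empty_config ->
  (forall s t, A t -> 0 < rate N g s t -> A s) -> [set s | valid N s] `<=` A.
Proof.
move=> A0 Apred s; have [n] := ubnP (workload s).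
elim: n s => // n IHn s sn sv.
have [->//|s0] := eqVneq s empty_config.
have [t [tv ts st]] := valid_succ sv s0.
by apply: (Apred _ t) => //; apply: IHn => //; apply: leq_trans ts _.
Qed.

(** Valid configurations are closed under transitions, so a law on [state N] stays balanced when
    extended by 0. *)
Lemma rate_valid s t : valid N s -> ~~ valid N t -> rate N g s t = 0.
Proof.
move=> sv tv; rewrite /rate -addrA service_rateE.
rewrite [X in X + _](_ : _ = 0) ?add0r.
  apply: big1 => j _; rewrite big_nat big1// => l ll; apply: big1 => i /eqP sl.
  have l1 : (1 <= l)%N by case/andP: ll.
  have /allP/(_ i) ji := forallP sv j.
  have {}ji : j \in route N i by apply: ji; apply/onthP; exists l.-1.
  have uv : valid N (remove_packet s j l).
    by rewrite -(valid_insert (remove_packet s j l) l ji) removeK.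
  rewrite /move_rate; case E : next_queue => [j'|] /=.
    have [_ j'i _] := next_queue_route E.
    by rewrite big1// => l' /eqP tE; move: tv; rewrite -tE valid_insert// uv.
  by case: eqP => // tE; move: tv; rewrite -tE uv.
apply: big1 => i _; have [j fj ji] := first_queue_ex N i.
rewrite fj big_Some /= big1// => l /eqP tE.
by move: tv; rewrite -tE valid_insert// sv.
Qed.

Definition extend0 (p : state N -> R) s : R := oapp p 0 (insub s).

Lemma extend0_val p (s : state N) : extend0 p (val s) = p s.
Proof. by rewrite /extend0 valK. Qed.

Lemma extend0_invalid p s : ~~ valid N s -> extend0 p s = 0.
Proof. by move=> sv; rewrite /extend0 insubN. Qed.

Lemma esum_state (F : config J I -> \bar R) :
  (forall s, ~~ valid N s -> F s = 0%E) ->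
  (\esum_(s in [set: state N]) F (val s) = \esum_(s in [set: config J I]) F s)%E.
Proof.
move=> F0; rewrite -esum_image; last by move=> s t _ _; exact: val_inj.
rewrite esum_mkcond; apply: eq_esum => s _; case: ifPn => // sN.
apply/esym/F0; apply: contra sN => sv; apply/mem_set.
by exists (Sub s sv) => //; rewrite SubK.
Qed.

Variable p : state N -> R.
Hypothesis p_stationary :
  stationary (fun s t : state N => rate N g (val s) (val t)) p.
Hypothesis g_bounded : exists K, forall i k, g i k <= K.

Let P := extend0 p.

Lemma stationary_ge0 s : 0 <= P s.
Proof.
rewrite /P /extend0; case: insubP => //= t _ _.
by case: p_stationary.
Qed.

Lemma stationary_sum1 : (\esum_(s in [set: config J I]) (P s)%:E = 1)%E.
Proof.
rewrite -esum_state => [|s sv]; last by rewrite /P extend0_invalid.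
by under eq_esum do rewrite /P extend0_val; case: p_stationary.
Qed.

Lemma stationary_balanced : balanced (rate N g) (exit_rate N g) P.
Proof.
move=> s; have [sv|sv] := boolP (valid N s); last first.
  rewrite /P extend0_invalid// mul0r esum1// => t _.
  have [tv|tv] := boolP (valid N t); first by rewrite rate_valid// mulr0.
  by rewrite extend0_invalid// mul0r.
pose t : state N := Sub s sv; have tE : s = val t by rewrite SubK.
have P0 := stationary_ge0; have r0 := rate_ge0 N g_gt0.
transitivity (\esum_(u in [set: state N]) (p u * rate N g (val u) (val t))%:E)%E.
  rewrite -esum_state => [|u uv]; last by rewrite /P extend0_invalid// mul0r.
  by apply: eq_esum => u _; rewrite /P extend0_val tE.
transitivity (\esum_(u in [set: state N]) (p t * rate N g (val t) (val u))%:E)%E.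
  have p0 u : 0 <= p u by rewrite -extend0_val.
  (* Both sides gain the same diagonal term, which [stationary] leaves out. *)
  rewrite (esum_setD1 t) => [|u]; last by rewrite lee_fin mulr_ge0.
  rewrite [RHS](esum_setD1 t) => [|u]; last by rewrite lee_fin mulr_ge0.
  by congr (_ + _)%E; case: p_stationary.
rewrite (@esum_state (fun u => (p t * rate N g (val t) u)%:E)) => [|u uv]; last first.
  by rewrite rate_valid ?mulr0// -tE.
under eq_esum do rewrite EFinM.
rewrite esumZl; first last.
- by move=> u _; rewrite lee_fin.
- by rewrite -extend0_val.
by rewrite rate_exit// -EFinM /P tE extend0_val.
Qed.

(** In [balanced_unique], [P] is the measure of finite mass and [weight] the other one. They are
    proportional with a nonzero constant, so the law passes from [weight] to [P]. *)
Lemma stationary_insertion_law : insertion_law N g P.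
Proof.
have [K gK] := g_bounded.
have exitK s : exit_rate N g s <= \sum_(i : I) K + \sum_j cap N j.
  apply: lerD; apply: ler_sum => // j _.
  have C0 := ltW (cap_gt0 N j).
  by case: (_ != _); rewrite ?mul1r// mul0r.
have P0 := stationary_ge0.
have Pval s : P s != 0 -> valid N s.
  by apply: contraNT => sv; rewrite /P extend0_invalid.
have Po : 0 < P empty_config.
  apply: (balanced_gt0 (rate_ge0 N g_gt0) P0 stationary_balanced valid_reach Pval).
  apply: contrapT => /forallNP P0'; have := stationary_sum1.
  rewrite esum1 => [/eqP|s _]; first by rewrite eqe eq_sym oner_eq0.
  by have /negP := P0' s; rewrite negbK => /eqP ->.
have wval s : ~~ valid N s -> weight N g s = 0.
  by move=> sv; rewrite /weight (negPf sv) !mul0r.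
have wE s : valid N s -> weight N g s = weight N g empty_config / P empty_config * P s.
  apply: (balanced_unique (rate_ge0 N g_gt0) (rate_exit N g_gt0) exitK P0 _ _
    stationary_balanced _ valid_reach Po).
  - exact: weight_ge0.
  - by rewrite stationary_sum1 ltry.
  - apply: insertion_law_balanced => //; first exact: weight_ge0.
    exact: weight_insertion_law.
set a := weight _ _ _ / _ in wE.
have a0 : a != 0.
  rewrite mulf_neq0// ?invr_neq0 ?gt_eqF// /weight.
  rewrite (_ : valid N empty_config); last first.
    by apply/forallP => j; rewrite ffunE.
  rewrite mul1r mulr_gt0//; last first.
    by apply: prodr_gt0 => j _; rewrite invr_gt0 exprn_gt0// cap_gt0.
  by apply: prodr_gt0 => i _; apply: prodr_gt0 => k _.
have PE s : P s = weight N g s / a.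
  have [sv|sv] := boolP (valid N s); first by rewrite wE// mulrC mulKf.
  by rewrite wval// mul0r /P extend0_invalid.
by move=> s j l i ji; rewrite !PE weight_insertion_law//; ring.
Qed.

End reachability.

(** * Identities for stationary means *)

Section equilibrium.
Context (R : realType) (J I : finType) (N : network R J I).
Variable g : I -> nat -> R.
Hypothesis g_gt0 : forall i k, 0 < g i k.
Variable P : config J I -> R.
Hypothesis P_ge0 : forall s, 0 <= P s.
Hypothesis P_law : insertion_law N g P.
Hypothesis P_valid : forall s, ~~ valid N s -> P s = 0.
Hypothesis P_sum1 : (\esum_(s in [set: config J I]) (P s)%:E = 1)%E.
Implicit Types (s : config J I) (j : J) (i : I) (l n : nat).

Definition flow i : \bar R :=
  (\esum_(s in [set: config J I]) (P s * g i (window N s i))%:E)%E.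

Lemma flow_ge0 i : (0 <= flow i)%E.
Proof. by apply: esum_ge0 => s _; rewrite lee_fin mulr_ge0// ltW. Qed.

Lemma flow_head i j : j \in route N i -> flow i =
  (\esum_(s in [set: config J I])
    (cap N j * P s *+ (packet_at s j 1 == Some i))%:E)%E.
Proof.
move=> ji; have C0 := cap_gt0 N j.
(* The boolean factor selects the insertion at position 1 in [esum_insert]. *)
pose F s l := (cap N j * P s *+ (l == 1%N))%:E.
transitivity (\esum_(s in [set: config J I])
    \sum_(1 <= l < (size (s j)).+2) F (insert_packet s j l i) l)%E.
  apply: eq_esum => s _; rewrite big_ltn// big_nat big1 ?adde0; last first.
    by move=> l /andP[l2 _]; rewrite /F gtn_eqF.
  by rewrite /F eqxx mulr1n P_law// [in RHS]mulrC divfK ?gt_eqF.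
rewrite -esum_insert => [|s l _]; last first.
  by rewrite lee_fin mulrn_wge0// mulr_ge0// ltW.
apply: eq_esum => s _; case E : (s j) => [|i0 r] /=.
  by rewrite big_geq// /packet_at E.
rewrite big_ltn_cond// [X in if _ then (_ + X)%E else X](_ : _ = 0%E).
  by rewrite /F eqxx adde0; case: eqP.
by rewrite big_nat_cond big1// => l /andP[/andP[l2 _] _]; rewrite /F gtn_eqF.
Qed.

Lemma flow_feasible j : (\sum_(i | j \in route N i) flow i <= (cap N j)%:E)%E.
Proof.
have C0 := cap_gt0 N j.
rewrite (eq_bigr _ (fun i ji => flow_head ji)) -esum_sum => [|s i _ _]; last first.
  by rewrite lee_fin mulrn_wge0// mulr_ge0// ltW.
apply: (@le_trans _ _ (\esum_(s in [set: config J I]) ((cap N j)%:E * (P s)%:E))%E).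
  apply: le_esum => s _; rewrite sumEFin lee_fin.
  have [i si|sN] := pickP (fun i => (j \in route N i) && (packet_at s j 1 == Some i)).
    case/andP: si => ji /eqP si; rewrite (bigD1 i)//= si eqxx mulr1n big1 ?addr0//.
    by move=> i' /andP[_ i'i]; rewrite (inj_eq Some_inj) eq_sym (negPf i'i).
  rewrite big1 ?mulr_ge0// ?(ltW C0)// => i ji.
  by have := sN i; rewrite ji /= => ->.
rewrite esumZl => [||s _]; rewrite ?lee_fin ?(ltW C0)//.
by rewrite P_sum1 mule1.
Qed.

Lemma flow_fin i : flow i \is a fin_num.
Proof.
have [j _ ji] := first_queue_ex N i.
rewrite ge0_fin_numE ?flow_ge0//.
apply: (le_lt_trans _ (ltry (cap N j))); apply: le_trans (flow_feasible j).
rewrite (bigD1 i)//= leeDl// sume_ge0// => i' _; exact: flow_ge0.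
Qed.

Definition total s : nat := (\sum_j size (s j))%N.

Lemma total_window s : valid N s -> total s = (\sum_i window N s i)%N.
Proof.
move=> sv; rewrite /total /window.
under eq_bigr do rewrite size_sum_count.
rewrite exchange_big; apply: eq_bigr => i _ /=; rewrite [RHS]big_mkcond.
by apply: eq_bigr => j _; case: ifPn => // ji; rewrite (count_at_notin sv).
Qed.

Lemma total_insert s j l i : total (insert_packet s j l i) = (total s).+1.
Proof.
rewrite /total; under eq_bigr do rewrite size_insert.
rewrite big_split /= -addn1; congr (_ + _)%N.
by rewrite (bigD1 j)//= eqxx big1// => j' /negPf ->.
Qed.

(** Functions of the population become bounded under this factor, so their means can be subtracted
    before any moment is known to be finite. *)
Definition trunc n s : R := (total s <= n)%N%:R.

Lemma trunc_ge0 n s : 0 <= trunc n s. Proof. exact: ler0n. Qed.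

Lemma trunc_le1 n s : trunc n s <= 1. Proof. by rewrite /trunc; case: (_ <= _)%N. Qed.

Local Open Scope ereal_scope.

(** After an insertion [window.-1] is the window before it, so the ratio cancels the factor [g] of
    [insertion_law]; removing the packet can only enlarge the truncation indicator. *)
Lemma trunc_count n j i : j \in route N i ->
  \esum_(s in [set: config J I])
    (P s * (trunc n s * (count_at s j i)%:R / g i (window N s i).-1))%:E <=
  ((cap N j)^-1)%:E * \esum_(s in [set: config J I])
    (P s * (trunc n s * (size (s j)).+1%:R))%:E.
Proof.
move=> ji; have C0 := cap_gt0 N j.
pose F s (l : nat) := (P s * (trunc n s / g i (window N s i).-1))%:E.
rewrite (eq_esum (b := fun s =>
    \sum_(1 <= l < (size (s j)).+1 | packet_at s j l == Some i) F s l)); last first.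
  move=> s _; rewrite /F sumEFin sum_packet_at_const -mulr_natr.
  by congr EFin; ring.
rewrite esum_insert => [|s l _]; last first.
  by rewrite lee_fin !mulr_ge0 ?trunc_ge0// invr_ge0 ltW.
rewrite -esumZl; first last.
- by move=> s _; rewrite lee_fin !mulr_ge0 ?trunc_ge0.
- by rewrite invr_ge0 ltW.
apply: le_esum => s _; rewrite /F sumEFin -EFinM lee_fin.
apply: (@le_trans _ _ (\sum_(1 <= l < (size (s j)).+2)
    (cap N j)^-1 * (P s * trunc n s))%R).
  apply: ler_sum => l _; rewrite P_law// window_insert// eqxx addn1 /=.
  have -> : forall x, (P s * g i (window N s i) / cap N j *
      (x / g i (window N s i)) = (cap N j)^-1 * (P s * x))%R.
    by move=> x; field; rewrite !gt_eqF.
  rewrite !ler_wpM2l// ?invr_ge0 ?(ltW C0)// /trunc total_insert ler_nat.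
  by case: (leqP _ n) => // /ltnW ->.
rewrite big_const_nat iter_addr_0 subn1 /= -[leLHS]mulr_natr -!mulrA.
by rewrite lexx.
Qed.

(** Queue by queue: insertions into [j] range over [size + 1] positions, and the weights
    [L i / cap N j] sum to at most 1 by feasibility. The extra position of each queue gives the term
    [#|J|]. *)
Lemma trunc_feasible n (L : I -> R) : feasible N L ->
  \esum_(s in [set: config J I]) (P s * (trunc n s *
    \sum_i L i * (window N s i)%:R / g i (window N s i).-1))%:E <=
  \esum_(s in [set: config J I]) (P s * (trunc n s * (total s + #|J|)%:R))%:E.
Proof.
move=> [L0 Lcap].
pose T j i s : \bar R :=
  (P s * (trunc n s * (count_at s j i)%:R / g i (window N s i).-1))%:E.
have T0 j i s : 0 <= T j i s.
  by rewrite lee_fin !mulr_ge0 ?trunc_ge0// invr_ge0 ltW.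
pose S j s : \bar R := (P s * (trunc n s * (size (s j)).+1%:R))%:E.
have S0 j s : 0 <= S j s by rewrite lee_fin !mulr_ge0 ?trunc_ge0.
rewrite (eq_esum (b := fun s =>
    \sum_j \sum_(i | j \in route N i) ((L i)%:E * T j i s))); last first.
  move=> s _; rewrite (exchange_big_dep xpredT)//= mulr_sumr mulr_sumr -sumEFin.
  apply: eq_bigr => i _; rewrite sumEFin -mulr_sumr; congr EFin.
  transitivity (L i * (\sum_(j in route N i)
      (P s * (trunc n s / g i (window N s i).-1)) * (count_at s j i)%:R))%R.
    by rewrite -mulr_sumr -natr_sum -/(window N s i); ring.
  congr (_ * _)%R; apply: eq_bigr => j _; ring.
rewrite [leRHS](eq_esum (b := fun s => \sum_j S j s)); last first.
  move=> s _; rewrite sumEFin -!mulr_sumr -natr_sum; congr (_ * (_ * _%:R))%:E.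
  by under [RHS]eq_bigr do rewrite -addn1; rewrite big_split /= sum1_card.
rewrite !esum_sum => [|s j _ _|s j _ _]; last 2 first.
- exact: S0.
- by apply: sume_ge0 => i _; rewrite mule_ge0// lee_fin.
apply: lee_sum => j _.
rewrite esum_sum => [|s i _ _]; last by rewrite mule_ge0// lee_fin.
have ES0 : 0 <= \esum_(s in [set: config J I]) S j s by apply: esum_ge0.
apply: (@le_trans _ _ (\sum_(i | j \in route N i)
    ((L i / cap N j)%:E * \esum_(s in [set: config J I]) S j s))).
  apply: lee_sum => i ji; rewrite esumZl//= EFinM -muleA lee_wpmul2l ?lee_fin//.
  exact: trunc_count.
rewrite -ge0_sume_distrl => [|i _]; last first.
  by rewrite lee_fin divr_ge0// ltW// cap_gt0.
rewrite sumEFin -mulr_suml -[leRHS]mul1e lee_wpmul2r// lee_fin.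
by rewrite ler_pdivrMr ?cap_gt0// mul1r.
Qed.

Local Close Scope ereal_scope.

(** For these functions the sum under [fine] in [mean] is finite, so [mean] is a genuine
    expectation. Inequalities are arranged so that every term is of this kind. *)
Definition nnbounded (f : config J I -> R) := exists K, forall s, 0 <= f s <= K.

Definition mean (f : config J I -> R) : R :=
  fine (\esum_(s in [set: config J I]) (P s * f s)%:E)%E.

Lemma nnbounded_cst k : 0 <= k -> nnbounded (fun=> k).
Proof. by move=> k0; exists k => s; rewrite k0 lexx. Qed.

Lemma nnboundedD f h : nnbounded f -> nnbounded h ->
  nnbounded (fun s => f s + h s).
Proof.
move=> [K fK] [K' hK']; exists (K + K') => s.
have /andP[? ?] := fK s; have /andP[? ?] := hK' s.
by rewrite addr_ge0//= lerD.
Qed.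

Lemma nnboundedM f h : nnbounded f -> nnbounded h ->
  nnbounded (fun s => f s * h s).
Proof.
move=> [K fK] [K' hK']; exists (K * K') => s.
have /andP[? ?] := fK s; have /andP[? ?] := hK' s.
by rewrite mulr_ge0//= ler_pM.
Qed.

Lemma nnbounded_sum (T : finType) (f : T -> config J I -> R) :
  (forall t, nnbounded (f t)) -> nnbounded (fun s => \sum_t f t s).
Proof.
move=> /choice[K fK]; exists (\sum_t K t) => s.
apply/andP; split; first by apply: sumr_ge0 => t _; case/andP: (fK t s).
by apply: ler_sum => t _; case/andP: (fK t s).
Qed.

Lemma nnbounded_bool (b : config J I -> bool) : nnbounded (fun s => (b s)%:R).
Proof. by exists 1 => s; case: (b s); rewrite ?ler01 lexx. Qed.

Lemma nnbounded_total n : nnbounded (fun s => trunc n s * (total s)%:R).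
Proof.
exists n%:R => s; rewrite /trunc; case: leqP => [sn|_].
  by rewrite mul1r ler0n ler_nat.
by rewrite mul0r lexx ler0n.
Qed.

Lemma mean_eq f : nnbounded f ->
  (\esum_(s in [set: config J I]) (P s * f s)%:E = (mean f)%:E)%E.
Proof.
move=> [K fK]; rewrite /mean fineK// ge0_fin_numE; last first.
  by apply: esum_ge0 => s _; rewrite lee_fin mulr_ge0//; case/andP: (fK s).
apply: (@le_lt_trans _ _ (\esum_(s in [set: config J I]) (`|K|%:E * (P s)%:E))%E).
  apply: le_esum => s _; rewrite -EFinM lee_fin mulrC ler_wpM2r//.
  by case/andP: (fK s) => _ /le_trans; apply; exact: ler_norm.
rewrite esumZl// => [|s _]; last by rewrite lee_fin.
by rewrite P_sum1 mule1 ltry.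
Qed.

Lemma le_mean f h : nnbounded f -> nnbounded h ->
  (forall s, valid N s -> f s <= h s) -> mean f <= mean h.
Proof.
move=> fb hb fh; rewrite -lee_fin -!mean_eq//; apply: le_esum => s _.
have [sv|sv] := boolP (valid N s); last by rewrite P_valid// !mul0r.
by rewrite lee_fin ler_wpM2l// fh.
Qed.

Lemma mean_ge0 f : nnbounded f -> 0 <= mean f.
Proof.
move=> fb; rewrite -lee_fin -mean_eq//; apply: esum_ge0 => s _.
by rewrite lee_fin mulr_ge0//; case: fb => K /(_ s) /andP[].
Qed.

Lemma meanD f h : nnbounded f -> nnbounded h ->
  mean (fun s => f s + h s) = mean f + mean h.
Proof.
move=> fb hb; apply: EFin_inj; rewrite EFinD -!mean_eq//; last exact: nnboundedD.
rewrite -esumD => [|s _|s _]; last 2 first.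
- by rewrite lee_fin mulr_ge0//; case: fb => K /(_ s) /andP[].
- by rewrite lee_fin mulr_ge0//; case: hb => K /(_ s) /andP[].
by apply: eq_esum => s _; rewrite mulrDr EFinD.
Qed.

Lemma meanZ k f : 0 <= k -> nnbounded f -> mean (fun s => k * f s) = k * mean f.
Proof.
move=> k0 fb; apply: EFin_inj; rewrite EFinM -!mean_eq//; last first.
  by apply: nnboundedM => //; exact: nnbounded_cst.
rewrite -esumZl// => [|s _]; last first.
  by rewrite lee_fin mulr_ge0//; case: fb => K /(_ s) /andP[].
by apply: eq_esum => s _; rewrite -EFinM mulrCA.
Qed.

Lemma mean_sum (T : finType) (f : T -> config J I -> R) :
  (forall t, nnbounded (f t)) ->
  mean (fun s => \sum_t f t s) = \sum_t mean (f t).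
Proof.
move=> fb; apply: EFin_inj; rewrite -mean_eq; last exact: nnbounded_sum.
rewrite -sumEFin; under [RHS]eq_bigr do rewrite -mean_eq//.
rewrite -esum_sum => [|s t _ _]; last first.
  by rewrite lee_fin mulr_ge0//; case: (fb t) => K /(_ s) /andP[].
by apply: eq_esum => s _; rewrite sumEFin mulr_sumr.
Qed.

Lemma eq_mean f h : (forall s, f s = h s) -> mean f = mean h.
Proof. by move=> fh; congr mean; apply/funext. Qed.

Lemma mean_cst k : 0 <= k -> mean (fun=> k) = k.
Proof.
move=> k0; rewrite (eq_mean (h := fun=> k * 1)) => [|s]; last by rewrite mulr1.
rewrite (meanZ k0 (nnbounded_cst ler01)).
suff -> : mean (fun=> 1) = 1 by rewrite mulr1.
rewrite /mean; under eq_esum do rewrite mulr1.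
by rewrite P_sum1.
Qed.

Lemma le_mean_flow f i : nnbounded f ->
  (forall s, f s <= g i (window N s i)) -> mean f <= fine (flow i).
Proof.
move=> fb fg; rewrite -lee_fin [leRHS]fineK ?flow_fin// -mean_eq//.
by apply: le_esum => s _; rewrite lee_fin ler_wpM2l.
Qed.

Lemma flow_feasible_real (L : I -> R) : (forall i, 0 <= L i) ->
  (forall i, L i <= fine (flow i)) -> feasible N L.
Proof.
move=> L0 Lf; split => // j; rewrite -lee_fin -sumEFin.
apply: le_trans (flow_feasible j); apply: lee_sum => i _.
by rewrite -[leRHS]fineK ?flow_fin// lee_fin.
Qed.

(** The sum of ratios is only a majorant: it stays an extended-real sum, controlled by
    [trunc_feasible], and drops out of the conclusion. *)
Lemma truncated_bound n (L : I -> R) (f h : config J I -> R) :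
  feasible N L -> nnbounded (fun s => trunc n s * f s) ->
  nnbounded (fun s => trunc n s * h s) ->
  (forall s, valid N s -> (total s <= n)%N -> f s <=
    \sum_i L i * (window N s i)%:R / g i (window N s i).-1 + h s) ->
  mean (fun s => trunc n s * f s) <=
  mean (fun s => trunc n s * (total s)%:R) + #|J|%:R +
  mean (fun s => trunc n s * h s).
Proof.
move=> Lf fb hb fh.
have tb : nnbounded (trunc n) by exact: nnbounded_bool.
have Jb : nnbounded (fun s => #|J|%:R * trunc n s).
  by apply: nnboundedM => //; exact: nnbounded_cst.
have TJb : nnbounded (fun s => trunc n s * (total s)%:R + #|J|%:R * trunc n s).
  by apply: nnboundedD => //; exact: nnbounded_total.
apply: (@le_trans _ _ (mean (fun s => trunc n s * (total s)%:R + #|J|%:R * trunc n s)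
    + mean (fun s => trunc n s * h s))); last first.
  rewrite lerD2r meanD//; last exact: nnbounded_total.
  rewrite lerD2l meanZ// ler_piMr//.
  rewrite -[leRHS](mean_cst ler01); apply: le_mean => // [|s _].
    exact: nnbounded_cst ler01.
  exact: trunc_le1.
rewrite -lee_fin EFinD -!mean_eq//.
have h0 s : 0 <= trunc n s * h s by case: hb => K /(_ s) /andP[].
apply: (@le_trans _ _ (\esum_(s in [set: config J I]) (P s * (trunc n s *
    \sum_i L i * (window N s i)%:R / g i (window N s i).-1))%:E +
    \esum_(s in [set: config J I]) (P s * (trunc n s * h s))%:E)%E); last first.
  apply: leeD => //; apply: le_trans (trunc_feasible n Lf) _.
  apply: le_esum => s _; rewrite lee_fin ler_wpM2l//.
  by rewrite natrD mulrDr [X in _ + X]mulrC.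
have [L0 _] := Lf.
rewrite -esumD => [|s _|s _]; first last.
- by rewrite lee_fin mulr_ge0.
- rewrite lee_fin !mulr_ge0 ?trunc_ge0//; apply: sumr_ge0 => i _.
  by rewrite divr_ge0 ?mulr_ge0// ltW.
apply: le_esum => s _; rewrite -EFinD lee_fin -mulrDr.
have [sv|sv] := boolP (valid N s); last by rewrite P_valid// !mul0r.
rewrite ler_wpM2l// -mulrDr /trunc; case: leqP => sn; last by rewrite !mul0r.
by rewrite !mul1r fh.
Qed.

(** With [f] twice the population, [truncated_bound] has the population once on the right.
    Subtracting its finite truncated mean leaves a bound free of the truncation level, and Markov's
    inequality concludes. *)
Lemma tight (L : I -> R) (K : R) m : feasible N L -> 0 <= K -> (0 < m)%N ->
  (forall i k, 2 * k%:R <= L i * k%:R / g i k.-1 + K) ->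
  1 - mean (trunc m) <= (#|J|%:R + #|I|%:R * K) / m%:R.
Proof.
move=> Lf K0 m0 LK; set C := #|J|%:R + #|I|%:R * K.
have tb n : nnbounded (trunc n) by exact: nnbounded_bool.
have totn n : mean (fun s => trunc n s * (total s)%:R) <= C.
  have Kb : nnbounded (fun s => trunc n s * (#|I|%:R * K)).
    by apply: nnboundedM => //; apply: nnbounded_cst; rewrite mulr_ge0.
  have Tb := nnbounded_total n.
  have := @truncated_bound n L (fun s => 2 * (total s)%:R) (fun=> #|I|%:R * K) Lf.
  have -> : mean (fun s => trunc n s * (2 * (total s)%:R)) =
      2 * mean (fun s => trunc n s * (total s)%:R).
    by rewrite -meanZ//; apply: eq_mean => s; ring.
  have -> : mean (fun s => trunc n s * (#|I|%:R * K)) = (#|I|%:R * K) * mean (trunc n).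
    by rewrite -meanZ ?mulr_ge0//; apply: eq_mean => s; ring.
  have H : (#|I|%:R * K) * mean (trunc n) <= #|I|%:R * K.
    rewrite ler_piMr ?mulr_ge0// -[leRHS](mean_cst ler01).
    apply: le_mean => // [|s _]; first exact: nnbounded_cst ler01.
    exact: trunc_le1.
  move=> /(_ _ Kb _) B; rewrite /C.
  suff : 2 * mean (fun s => trunc n s * (total s)%:R) <=
      mean (fun s => trunc n s * (total s)%:R) + #|J|%:R +
      #|I|%:R * K * mean (trunc n) by lra.
  apply: B.
    have := nnboundedM (nnbounded_cst (ler0n R 2)) Tb.
    by move=> [K' bK']; exists K' => s; rewrite mulrCA; exact: bK'.
  move=> s sv _; rewrite total_window// natr_sum mulr_sumr.
  have -> : #|I|%:R * K = \sum_(i : I) K by rewrite sumr_const mulr_natl.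
  by rewrite -big_split /=; apply: ler_sum => i _.
have tot : (\esum_(s in [set: config J I]) (P s * (total s)%:R)%:E <= C%:E)%E.
  apply: ge_ereal_sup => _ [X [finX _] <-].
  have /finite_seqP[r XE] := finX.
  (* A finite set of states lies below some truncation level, so the bound passes to the full
     mean. *)
  pose n := (\sum_(x <- r) total x)%N.
  apply: le_trans (_ : ((mean (fun s => trunc n s * (total s)%:R))%:E <= _)%E);
    last by rewrite lee_fin.
  rewrite -mean_eq; last exact: nnbounded_total.
  apply: esum_ge; exists X => //; apply: lee_fsum => // s.
  rewrite XE /= => sr; rewrite lee_fin ler_wpM2l// /trunc.
  by rewrite (_ : (total s <= n)%N) ?mul1r// /n (big_rem s)//= leq_addr.
have cb : nnbounded (fun s => (~~ (total s <= m)%N)%:R) by exact: nnbounded_bool.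
have -> : 1 - mean (trunc m) = mean (fun s => (~~ (total s <= m)%N)%:R).
  apply/eqP; rewrite subr_eq -meanD// -{1}[1](mean_cst ler01); apply/eqP/eq_mean => s.
  by rewrite /trunc; case: leqP => _; rewrite ?add0r ?addr0.
rewrite ler_pdivlMr ?ltr0n// mulrC -meanZ// -lee_fin.
rewrite -mean_eq; last by apply: nnboundedM => //; exact: nnbounded_cst.
apply: le_trans tot; apply: le_esum => s _; rewrite lee_fin ler_wpM2l//.
by case: leqP => sm; rewrite ?mulr0// mulr1 ler_nat ltnW.
Qed.

(** [z] is a bounded substitute for [g]: its truncated means lie below the throughputs, hence are
    feasible, and [fo] compares them with [L]. The terms [w i * L i] are collected only under
    truncation, and the complement costs the last summand. *)
Lemma underuse_bound n (c eps : R) (L w kappa delta Z : I -> R) (z : I -> nat -> R) :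
  0 < c -> 0 <= eps -> feasible N L ->
  (forall i, 0 <= w i) -> (forall i, 0 <= kappa i) ->
  (forall i k, 0 <= z i k <= Z i) -> (forall i k, z i k <= g i k) ->
  (forall L', feasible N L' -> \sum_i w i * (L' i - L i) <= 0) ->
  (forall i k, (k <= n)%N ->
    k%:R + c * (w i * L i) + c * (kappa i * (g i k <= L i - delta i)%R%:R) <=
    L i * k%:R / g i k.-1 + c * (w i * z i k) + c * eps) ->
  \sum_i kappa i *
    mean (fun s => trunc n s * (g i (window N s i) <= L i - delta i)%R%:R) <=
  #|J|%:R / c + #|I|%:R * eps + (1 - mean (trunc n)) * \sum_i w i * L i.
Proof.
move=> c0 eps0 Lf w0 kappa0 zZ zg fo H.
have [L0 _] := Lf.
have tb : nnbounded (trunc n) by exact: nnbounded_bool.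
pose bad i s : R := (g i (window N s i) <= L i - delta i)%R%:R.
pose A s : R := trunc n s * (total s)%:R.
have Ab : nnbounded A by exact: nnbounded_total.
have wL0 : 0 <= \sum_i w i * L i by apply: sumr_ge0 => i _; rewrite mulr_ge0.
pose B i s := c * (kappa i * (trunc n s * bad i s)).
have badb i : nnbounded (fun s => trunc n s * bad i s).
  by apply: nnboundedM => //; exact: nnbounded_bool.
have Bb i : nnbounded (B i).
  by do 2![apply: nnboundedM; first by apply: nnbounded_cst => //; exact: ltW].
pose WL := \sum_i w i * L i.
pose W s := (c * WL) * trunc n s.
have Wb : nnbounded W.
  by apply: nnboundedM => //; apply: nnbounded_cst; rewrite mulr_ge0// ltW.
have zb i : nnbounded (fun s => trunc n s * z i (window N s i)).
  by apply: nnboundedM => //; exists (Z i) => s; exact: zZ.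
pose D i s := c * (w i * (trunc n s * z i (window N s i))).
have Db i : nnbounded (D i).
  by do 2![apply: nnboundedM; first by apply: nnbounded_cst => //; exact: ltW].
pose E s := (c * (#|I|%:R * eps)) * trunc n s.
have ceps0 : 0 <= c * (#|I|%:R * eps) by rewrite !mulr_ge0// ltW.
have Eb : nnbounded E by apply: nnboundedM => //; exact: nnbounded_cst.
pose f s := (total s)%:R + c * WL + \sum_i c * (kappa i * bad i s).
pose h s := \sum_i c * (w i * z i (window N s i)) + c * (#|I|%:R * eps).
have fE s : trunc n s * f s = A s + W s + \sum_i B i s.
  rewrite /f !mulrDr /A /W [_ * trunc n s]mulrC; congr (_ + _).
  rewrite mulr_sumr.
  by apply: eq_bigr => i _; rewrite /B; ring.
have hE s : trunc n s * h s = \sum_i D i s + E s.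
  rewrite /h mulrDr /E [_ * trunc n s]mulrC; congr (_ + _).
  rewrite mulr_sumr.
  by apply: eq_bigr => i _; rewrite /D; ring.
have AWb : nnbounded (fun s => A s + W s) by exact: nnboundedD.
have SBb : nnbounded (fun s => \sum_i B i s) by exact: nnbounded_sum.
have SDb : nnbounded (fun s => \sum_i D i s) by exact: nnbounded_sum.
have fb : nnbounded (fun s => trunc n s * f s).
  by case: (nnboundedD AWb SBb) => K bK; exists K => s; rewrite fE.
have hb : nnbounded (fun s => trunc n s * h s).
  by case: (nnboundedD SDb Eb) => K bK; exists K => s; rewrite hE.
have fh s : valid N s -> (total s <= n)%N ->
    f s <= \sum_i L i * (window N s i)%:R / g i (window N s i).-1 + h s.
  move=> sv sn; rewrite /f /h total_window// natr_sum /WL mulr_sumr.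
  have -> : c * (#|I|%:R * eps) = \sum_(i : I) c * eps.
    by rewrite sumr_const -mulr_natl; ring.
  rewrite -!big_split /=; apply: ler_sum => i _; rewrite addrA.
  apply: H; apply: leq_trans sn; rewrite total_window//.
  by rewrite (bigD1 i)//= leq_addr.
have := truncated_bound Lf fb hb fh.
rewrite (eq_mean fE) (eq_mean hE).
rewrite (meanD AWb SBb) (meanD Ab Wb) (mean_sum Bb) (meanD SDb Eb) (mean_sum Db).
rewrite [mean W]meanZ// ?mulr_ge0// ?(ltW c0)// [mean E]meanZ//.
have -> : \sum_i mean (B i) =
    c * \sum_i kappa i * mean (fun s => trunc n s * bad i s).
  rewrite mulr_sumr; apply: eq_bigr => i _; rewrite [LHS]meanZ ?(ltW c0) ?meanZ//.
  by apply: nnboundedM => //; exact: nnbounded_cst.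
have -> : \sum_i mean (D i) =
    c * \sum_i w i * mean (fun s => trunc n s * z i (window N s i)).
  rewrite mulr_sumr; apply: eq_bigr => i _; rewrite [LHS]meanZ ?(ltW c0) ?meanZ//.
  by apply: nnboundedM => //; exact: nnbounded_cst.
set SB := \sum_i kappa i * _; set X := mean (trunc n).
have X1 : X <= 1.
  rewrite -[leRHS](mean_cst ler01); apply: le_mean => // [|s _].
    exact: nnbounded_cst ler01.
  exact: trunc_le1.
have := fo (fun i => mean (fun s => trunc n s * z i (window N s i))).
have /[swap]/[apply] : feasible N
    (fun i => mean (fun s => trunc n s * z i (window N s i))).
  apply: flow_feasible_real => i; first exact: mean_ge0.
  apply: le_mean_flow => // s; apply: le_trans (zg i (window N s i)).
  by rewrite ler_piMl ?trunc_le1//; case/andP: (zZ i (window N s i)).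
under eq_bigr do rewrite mulrBr; rewrite sumrB.
set SZ := \sum_i w i * mean _; rewrite -/WL => foZ.
move=> main.
have IE : 0 <= c * (#|I|%:R * eps) * (1 - X) by rewrite mulr_ge0// subr_ge0.
rewrite -(ler_pM2l c0) !mulrDr [c * (_ / c)]mulrC divfK ?gt_eqF//.
have : c * SZ <= c * WL by rewrite ler_pM2l//; lra.
by nra.
Qed.

Lemma flow_ge_of_underuse n (L delta : R) i : 0 <= delta <= L ->
  (L - delta) * mean (trunc n) <= fine (flow i) +
  L * mean (fun s => trunc n s * (g i (window N s i) <= L - delta)%R%:R).
Proof.
move=> /andP[d0 dL]; set bad := fun s => trunc n s * _.
have tb : nnbounded (trunc n) by exact: nnbounded_bool.
have badb : nnbounded bad by apply: nnboundedM => //; exact: nnbounded_bool.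
have Ld0 : 0 <= L - delta by rewrite subr_ge0.
pose good s := trunc n s * (L - delta < g i (window N s i))%R%:R.
have goodb : nnbounded good by apply: nnboundedM => //; exact: nnbounded_bool.
have goodZ : nnbounded (fun s => (L - delta) * good s).
  by apply: nnboundedM => //; exact: nnbounded_cst.
have -> : mean (trunc n) = mean good + mean bad.
  rewrite -meanD//; apply: eq_mean => s; rewrite /good /bad -mulrDr.
  by case: leP => _; rewrite ?add0r ?addr0 mulr1.
rewrite mulrDr lerD//; last by rewrite ler_wpM2r ?mean_ge0// gerBl.
rewrite -meanZ//; apply: le_mean_flow => // s; rewrite /good.
case: ltP => [/ltW gL|_]; last by rewrite !mulr0 ltW.
by rewrite mulr1; apply: le_trans gL; rewrite ler_piMr ?trunc_le1.
Qed.

End equilibrium.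

(** * Utilities and congestion windows *)

Lemma derivable_cvg_quotient (R : realType) (f : R -> R) (x : R) :
  derivable f x 1 ->
  (h^-1 * (f (h + x) - f x)) @[h --> 0^'] --> derive1 f x.
Proof.
rewrite /derivable /derive1 => df.
suff <- : (fun h : R => h^-1 *: ((f \o shift x) (h *: 1) - f x)) =
    (fun h => h^-1 * (f (h + x) - f x)) by exact: df.
by apply/funext => h; rewrite /= [_ *: 1]mulr1.
Qed.

(** Chords from [x] towards [y] get steeper (in that direction) as they shorten. If [y] were above
    the tangent by [S], the quotients at steps [t * (y - x)] would stay more than [S / |y - x|] away
    from the derivative. *)
Lemma concave_tangent_le (R : realType) (D : set R) (f : R -> R) (x y : R) :
  strictly_concave D f -> D x -> D y -> derivable f x 1 ->
  f y <= f x + derive1 f x * (y - x).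
Proof.
move=> cf Dx Dy df; have [->|xy] := eqVneq y x; first by rewrite subrr mulr0 addr0.
have h0 : y - x != 0 by rewrite subr_eq0.
have nh0 : 0 < `|y - x| by rewrite normr_gt0.
rewrite leNgt; apply/negP => gap.
set S := f y - f x - derive1 f x * (y - x).
have S0 : 0 < S by rewrite /S; lra.
have e0 : 0 < S / `|y - x| by rewrite divr_gt0.
have /cvgrPdist_lt/(_ _ e0) := derivable_cvg_quotient df.
rewrite near_withinE => /nbhs_ballP[d /= d0 dP].
pose t := Num.min 2^-1 (d / (2 * `|y - x|)).
have t0 : 0 < t by rewrite lt_min invr_gt0 ltr0n divr_gt0// mulr_gt0.
have t1 : t < 1 by rewrite gt_min invf_lt1 ?ltr1n.
have th0 : t * (y - x) != 0 by rewrite mulf_neq0// gt_eqF.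
have td : t * `|y - x| < d.
  apply: (@le_lt_trans _ _ (d / (2 * `|y - x|) * `|y - x|)).
    by rewrite ler_wpM2r// ge_min lexx orbT.
  rewrite invfM mulrA divfK ?gt_eqF//; lra.
have bt : ball 0 d (t * (y - x)).
  by rewrite /ball /= sub0r normrN normrM gtr0_norm.
have := dP _ bt th0.
have cft : t * (f y - f x) < f (t * (y - x) + x) - f x.
  have := cf y x t Dy Dx xy t0 t1.
  have -> : t * y + (1 - t) * x = t * (y - x) + x by ring.
  lra.
set q := _^-1 * _ => qlt.
have qE : q * (y - x) = (f (t * (y - x) + x) - f x) / t.
  by rewrite /q; field; rewrite h0 gt_eqF.
have : f y - f x < q * (y - x) by rewrite qE ltr_pdivlMr// mulrC.
have : q * (y - x) - derive1 f x * (y - x) < S.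
  rewrite -mulrBl; apply: le_lt_trans (ler_norm _) _.
  by rewrite normrM distrC -ltr_pdivlMr.
by rewrite /S; lra.
Qed.

Lemma concave_tangent_lt (R : realType) (D : set R) (f : R -> R) (x y : R) :
  strictly_concave D f -> D x -> D y -> D (2^-1 * y + (1 - 2^-1) * x) ->
  derivable f x 1 -> y != x -> f y < f x + derive1 f x * (y - x).
Proof.
move=> cf Dx Dy Dz df yx.
have := concave_tangent_le cf Dx Dz df.
have h0 : (0 : R) < 2^-1 by rewrite invr_gt0.
have h1 : (2^-1 : R) < 1 by rewrite invf_lt1 ?ltr1n.
have := cf y x 2^-1 Dy Dx yx h0 h1.
set fz := f _.
have -> : 2^-1 * y + (1 - 2^-1) * x - x = 2^-1 * (y - x) by ring.
by lra.
Qed.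

Section route.
Context (R : realType) (U : R -> R).
Hypothesis U_utility : utility U.
Hypothesis U_assumption1 : assumption1 U.
Hypothesis U_assumption2 : assumption2 U.
Implicit Types x y m : R.

(* The derivative of [lam |-> U (expR lam)] at [lam = ln x]. *)
Definition demand x := x * derive1 U x.

Lemma utility_tangent x y : 0 < x -> 0 < y ->
  U y <= U x + derive1 U x * (y - x).
Proof.
by case: U_utility => _ cU dU _ x0 y0; apply: concave_tangent_le cU _ _ (dU _ _).
Qed.

Lemma utility_derive_gt0 x : 0 < x -> 0 < derive1 U x.
Proof.
move=> x0; have x2 : x < 2 * x by lra.
have := @utility_tangent x (2 * x) x0; rewrite mulr_gt0// => /(_ isT).
case: U_utility => /(_ _ _ x0 x2) ux _ _ _ H.
have : 0 < derive1 U x * x by nra.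
by rewrite pmulr_lgt0.
Qed.

Lemma demand_gt0 x : 0 < x -> 0 < demand x.
Proof. by move=> x0; rewrite mulr_gt0// utility_derive_gt0. Qed.

Lemma exp_utility_derive (lam : R) : derivable (fun l => U (expR l)) lam 1 /\
  derive1 (fun l => U (expR l)) lam = demand (expR lam).
Proof.
case: U_utility => _ _ dU _.
have dUe : derivable U (expR lam) 1 by apply: dU; rewrite expR_gt0.
have dd : is_derive lam 1 (U \o expR) (derive1 U (expR lam) * expR lam).
  apply: (@is_derive1_comp R U (@expR R)).
  by apply: DeriveDef => //; rewrite derive1E.
split; first by case: dd.
by rewrite /demand [RHS]mulrC [LHS]derive1E; case: dd.
Qed.

Lemma exp_utility_tangent x y : 0 < x -> 0 < y -> y != x ->
  U y < U x + demand x * (ln y - ln x).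
Proof.
move=> x0 y0 yx.
have [d1 d2] := exp_utility_derive (ln x).
have := concave_tangent_lt U_assumption1 (x := ln x) (y := ln y) I I I d1.
rewrite d2 !lnK ?posrE//; apply.
by apply: contra yx => /eqP/ln_inj ->//; rewrite posrE.
Qed.

(** The tangent inequalities at [x] and at [y] add up to [0 < (demand x - demand y) * (ln y - ln
    x)]. *)
Lemma demand_lt x y : 0 < x -> x < y -> demand y < demand x.
Proof.
move=> x0 xy; have y0 := lt_trans x0 xy.
have := exp_utility_tangent x0 y0; rewrite gt_eqF// => /(_ isT).
have := exp_utility_tangent y0 x0; rewrite lt_eqF// => /(_ isT).
have : ln x < ln y by rewrite ltr_ln ?posrE.
by nra.
Qed.

Lemma demand_le x y : 0 < x -> 0 < y -> (demand y <= demand x) = (x <= y).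
Proof.
move=> x0 y0; apply/idP/idP; last first.
  by rewrite le_eqVlt => /predU1P[->//|/(demand_lt x0)/ltW].
by apply: contraTT; rewrite -!ltNge => /(demand_lt y0).
Qed.

Lemma utility_derive_lt x y : 0 < x -> x < y -> derive1 U y < derive1 U x.
Proof.
move=> x0 xy; have y0 := lt_trans x0 xy.
have := demand_lt x0 xy; rewrite /demand => H.
rewrite -(ltr_pM2l x0); apply: le_lt_trans H.
by rewrite ler_pM2r ?utility_derive_gt0// ltW.
Qed.

Lemma Gfun_le m x : 0 < x -> (Gfun U m <= (m * ln x - U x)%:E)%E.
Proof.
move=> x0; rewrite /Gfun leeNl -EFinN opprB; apply: ereal_sup_ubound.
by exists (ln x) => //; rewrite lnK ?posrE.
Qed.

(** By the tangent inequality the supremum defining [Gfun] at [demand x] is attained at [ln x],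
    which is therefore a supergradient of [G] there. *)
Lemma Gfun_demand x : 0 < x ->
  Gfun U (demand x) = (demand x * ln x - U x)%:E.
Proof.
move=> x0; apply/eqP; rewrite eq_le Gfun_le//=.
rewrite /Gfun leeNr -EFinN opprB; apply: ge_ereal_sup => _ [lam _ <-].
rewrite lee_fin; have [<-|lx] := eqVneq (expR lam) x.
  by rewrite expRK; lra.
have := exp_utility_tangent x0 (expR_gt0 lam) lx; rewrite expRK; lra.
Qed.

Lemma G_supergradient m x : 0 < x -> Gfun U m \is a fin_num ->
  fine (Gfun U m) <= fine (Gfun U (demand x)) + ln x * (m - demand x).
Proof.
move=> x0 mf; rewrite Gfun_demand//=.
by have := Gfun_le m x0; rewrite -[Gfun U m]fineK// lee_fin; lra.
Qed.

(** The candidate is [x = expR (G' m)]. If [demand x] differed from [m], the strict tangent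
    inequality of [G] at [m] and the supergradient inequality at [demand x], both of slope [ln x],
    would contradict each other. *)
Lemma demand_surj m : 0 < m -> exists2 x, 0 < x & demand x = m.
Proof.
move=> m0; case: U_assumption2 => Gfin Gc Gd _.
have [dG _] := Gd m m0.
set G := fine \o Gfun U in Gc Gd dG.
pose x := expR (derive1 G m); have x0 : 0 < x by rewrite expR_gt0.
exists x => //; apply/eqP; apply: contraT => xm.
have n0 := demand_gt0 x0.
have z0 : 0 < 2^-1 * demand x + (1 - 2^-1) * m by lra.
have := concave_tangent_lt Gc m0 n0 z0 dG xm.
have := G_supergradient x0 (Gfin _ m0).
by rewrite /G /= {1}/x expRK; lra.
Qed.

(** Takes the place of the mean value theorem, since [a] may be 0, where only finiteness of [G] is
    given. If [demand x] lay outside, the supergradient at the nearer endpoint would be on the wrong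
    side of the secant slope. *)
Lemma G_slope (a b x : R) : 0 <= a -> a < b -> 0 < x ->
  Gfun U a \is a fin_num -> Gfun U b \is a fin_num ->
  ln x * (b - a) = fine (Gfun U b) - fine (Gfun U a) ->
  a <= demand x <= b.
Proof.
move=> a0 ab x0 fa fb xE; have b0 := le_lt_trans a0 ab.
apply/andP; split; rewrite leNgt; apply/negP => H.
- have {}a0 := lt_trans (demand_gt0 x0) H.
  have [y y0 ya] := demand_surj a0.
  have := G_supergradient y0 fb; rewrite ya.
  have : ln y < ln x by rewrite ltr_ln ?posrE// ltNge -demand_le// -ltNge ya.
  by nra.
- have [y y0 yb] := demand_surj b0.
  have := G_supergradient y0 fa; rewrite yb.
  have : ln x < ln y by rewrite ltr_ln ?posrE// ltNge -demand_le// -ltNge yb.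
  by nra.
Qed.

(** [ln (gc U d c k)] is the secant slope of [G] between consecutive scaled windows, which are
    [1 / c] apart: the source of the O(1 / c) error. *)
Lemma gc_demand (d : nat -> R) c k : (0 < c)%N -> Gc_well_defined U d ->
  scaled_arg d c k <= demand (gc U d c k) <= scaled_arg d c k.+1.
Proof.
move=> c0 dwf; have cR : (0 : R) < c%:R by rewrite ltr0n.
have [k0 kf] := dwf c k c0; have [_ k1f] := dwf c k.+1 c0.
have E : scaled_arg d c k.+1 - scaled_arg d c k = c%:R^-1.
  by rewrite /scaled_arg -[k.+1]addn1 natrD; ring.
apply: G_slope => //.
- by rewrite -subr_gt0 E invr_gt0.
- exact: expR_gt0.
- rewrite E /gc expRK /Gc; field; by rewrite gt_eqF.
Qed.

End route.

(** * The inequality for a single route *)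

Section pointwise.
Context (R : realType) (U : R -> R).
Hypothesis U_utility : utility U.
Hypothesis U_assumption1 : assumption1 U.
Hypothesis U_assumption2 : assumption2 U.

(** A uniform gap from strict monotonicity alone: on a grid of step [e / 2], a whole cell lies
    between [x] and any [y >= x + e], and finitely many cells cover the range of [x]. *)
Lemma demand_gap (a A e : R) : 0 < a -> 0 < e ->
  exists2 eta, 0 < eta & forall x y, a <= x -> x <= A -> x + e <= y ->
    eta <= demand U x - demand U y.
Proof.
move=> a0 e0; pose h := e / 2; have h0 : 0 < h by rewrite divr_gt0.
have demand_le' x y : 0 < x -> x <= y -> demand U y <= demand U x.
  by move=> x0 xy; rewrite demand_le// (lt_le_trans x0).
suff gap M : exists2 eta, 0 < eta & forall x y, a <= x -> x <= a + M%:R * h ->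
    x + e <= y -> eta <= demand U x - demand U y.
  have [eta eta0 gapM] := gap (Num.Def.archi_bound (A / h)).
  exists eta => // x y ax xA xy; apply: gapM => //; apply: le_trans xA _.
  have [A0|A0] := leP A 0; first by rewrite (le_trans A0)// addr_ge0 ?mulr_ge0 ?ltW.
  have := archi_boundP (divr_ge0 (ltW A0) (ltW h0)).
  by rewrite ltr_pdivrMr// => /ltW; lra.
elim: M => [|M [eta eta0 gapM]].
  exists (demand U a - demand U (a + e)) => [|x y ax xa xy].
    by rewrite subr_gt0 demand_lt// ltrDl.
  have <- : x = a by apply/eqP; rewrite eq_le ax andbT; lra.
  by rewrite lerD2l lerN2 demand_le'//; lra.
have Mh0 : 0 <= M%:R * h by rewrite mulr_ge0// ltW.
pose y1 := a + M.+1%:R * h; pose y2 := y1 + h.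
have y1E : y1 = a + M%:R * h + h by rewrite /y1 -addn1 natrD; ring.
exists (Num.min eta (demand U y1 - demand U y2)).
  by rewrite lt_min eta0 subr_gt0 demand_lt// /y2; lra.
move=> x y ax xM xy; have [xM'|xM'] := leP x (a + M%:R * h).
  by rewrite ge_min gapM.
rewrite ge_min; apply/orP; right; apply: lerB; apply: demand_le'.
- by lra.
- exact: xM.
- by rewrite /y2; lra.
- have hE : e = h + h by rewrite /h; lra.
  by rewrite /y2; lra.
Qed.

(* The scalar inequality that drives the proof: [g k] is the sending rate with
   [k] packets in flight, and [g k] times [derive1 U (g k)] is [k / c] up to
   [O(1 / c)]. *)
Lemma window_pointwise (D L delta B eps : R) : 0 <= D -> 0 < delta < L ->
  0 < B -> 0 < eps ->
  let w := derive1 U L in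
  let kappa := (derive1 U (L - delta / 2) - w) * (delta / 2) in
  exists2 c0 : R, 0 < c0 & forall (c : R) (g : nat -> R), c0 <= c ->
    (forall k, 0 < g k) ->
    (forall k, k%:R / c <= demand U (g k) <= (k.+1%:R + D) / c) ->
    forall k, k%:R / c <= B ->
    k%:R / c + w * L + kappa * (g k <= L - delta)%R%:R <=
    L * (k%:R / c) / g k.-1 + w * Num.min (g k) (2 * L) + eps.
Proof.
move=> D0 /andP[d0 dL] B0 eps0 w kappa.
have L0 : 0 < L by lra.
have w0 : 0 < w by exact: utility_derive_gt0.
have k0 : 0 < kappa.
  by rewrite mulr_gt0 ?divr_gt0// subr_gt0 utility_derive_lt//; lra.
have BD0 : 0 < B + 1 + D by lra.
(* [a] will bound [g j] from below as long as [j / c <= B]. *)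
have [a a0 aE] := demand_surj U_utility U_assumption1 U_assumption2 BD0.
(* [e1] bounds the excess of [g k.-1] over [g k]: it costs half of [eps], and [delta / 2] keeps
   [g k.-1] below [L - delta / 2] when [g k <= L - delta]. *)
pose e1 := Num.min (eps / (2 * w)) (delta / 2).
have e10 : 0 < e1 by rewrite lt_min !divr_gt0// mulr_gt0.
have e1d : e1 <= delta / 2 by rewrite ge_min lexx orbT.
have e1w : w * e1 <= eps / 2.
  apply: (@le_trans _ _ (w * (eps / (2 * w)))).
    by rewrite ler_pM2l// ge_min lexx.
  by rewrite le_eqVlt; apply/orP; left; apply/eqP; field; rewrite gt_eqF.
have [eta eta0 gap] := demand_gap (2 * L) a0 e10.
have L20 : 0 < 2 * L by lra.
have dL20 := demand_gt0 U_utility L20.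
(* [Q] bounds [|L / x - 1|] for [x >= a]; the other half of [eps] pays for replacing [k / c] by the
   demand at [g k.-1]. *)
pose Q := L / a + 1.
have Q0 : 0 < Q by rewrite addr_gt0// divr_gt0.
pose m := Num.min (Num.min eta (demand U (2 * L))) (Num.min (eps / (2 * Q)) 1).
have m0 : 0 < m by rewrite !lt_min eta0 dL20 ltr01 divr_gt0// mulr_gt0.
have mE : [/\ m <= eta, m <= demand U (2 * L), m <= eps / (2 * Q) & m <= 1].
  by split; rewrite /m !ge_min lexx ?orbT.
exists ((3 + D) / m) => [|c g c0c g0 gE k kB]; first by rewrite divr_gt0//; lra.
have c0 : 0 < c by apply: lt_le_trans c0c; rewrite divr_gt0//; lra.
have mc : (3 + D) / c <= m by rewrite ler_pdivrMr// mulrC -ler_pdivrMr.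
set ci := c^-1; have ci0 : 0 < ci by rewrite invr_gt0.
have {}mc : (3 + D) * ci <= m := mc.
have {}gE j : j%:R * ci <= demand U (g j) /\ demand U (g j) <= j%:R * ci + (1 + D) * ci.
  have /andP[? H] := gE j; split => //; suff <- : (j.+1%:R + D) * ci =
    j%:R * ci + (1 + D) * ci by exact: H.
  by rewrite -[j.+1]addn1 natrD; ring.
have Dci : 0 <= D * ci by rewrite mulr_ge0// ltW.
case: mE => m1 m2 m3 m4.
have ga j : j%:R * ci <= B -> a <= g j.
  move=> jB; rewrite -(demand_le U_utility U_assumption1)// aE.
  by have [_] := gE j; lra.
(* When the cap is active the capped term is [2 * w * L], while
   [k / c <= demand U (g k) <= w * L]. *)
have [gk2|gk2] := leP (2 * L) (g k).
  have -> : (g k <= L - delta) = false by apply/negbTE; rewrite -ltNge; lra.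
  rewrite mulr0 addr0.
  have kd : k%:R * ci <= w * L.
    have [/le_trans + _] := gE k; apply.
    by rewrite /w mulrC -/(demand U L) (demand_le U_utility)//; lra.
  have : 0 <= L * (k%:R / c) / g k.-1.
    by rewrite !mulr_ge0 ?invr_ge0 ?(ltW L0) ?(ltW c0)// ltW.
  rewrite /ci in kd *; have := ltW eps0; lra.
(* For an empty window the demand is at most [(1 + D) / c], too small for a rate below [2 * L]; so
   [k.-1] is a true predecessor. *)
case: k => [|k] in kB gk2 *.
  exfalso; move: gk2; apply/negP; rewrite -leNgt.
  rewrite -(demand_le U_utility U_assumption1)//.
  by have [_] := gE 0%N; rewrite mul0r add0r; lra.
rewrite /=; set x' := g k.+1; set x := g k.
have kB' : k%:R * ci <= B.
  by apply: le_trans kB; rewrite ler_wpM2r ?(ltW ci0)// ler_nat.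
have ax' : a <= x' by exact: ga.
have ax : a <= x by exact: ga.
have x0 : 0 < x by exact: g0.
have [kx1 kx2] := gE k; have [kx1' kx2'] := gE k.+1.
have kS : k.+1%:R * ci = k%:R * ci + ci by rewrite -addn1 natrD mulrDl mul1r.
(* Demands at consecutive windows differ by at most [(2 + D) / c < eta]. *)
have xx' : x <= x' + e1.
  rewrite leNgt; apply/negP => /ltW xx'; have := gap x' x ax' (ltW gk2) xx'.
  rewrite -/x -/x' in kx1 kx2 kx1' kx2'; lra.
have dx : demand U x * (L / x - 1) = derive1 U x * (L - x).
  by rewrite /demand; field; rewrite gt_eqF.
have Lx : `|L / x - 1| <= Q.
  apply: le_trans (ler_normB _ _) _; rewrite normr1 lerD2r.
  by rewrite gtr0_norm ?divr_gt0// ler_pM2l// lef_pV2 ?posrE.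
have kx : `|k.+1%:R * ci - demand U x| <= (3 + D) * ci.
  rewrite -/x in kx1 kx2; rewrite ler_norml kS; apply/andP; split; lra.
have main1 : demand U x * (L / x - 1) - eps / 2 <= k.+1%:R * ci * (L / x - 1).
  have : `|(k.+1%:R * ci - demand U x) * (L / x - 1)| <= eps / 2.
    rewrite normrM; apply: (@le_trans _ _ (m * Q)).
      by apply: ler_pM => //; apply: le_trans kx _.
    apply: (@le_trans _ _ (eps / (2 * Q) * Q)); first by rewrite ler_pM2r.
    by rewrite le_eqVlt; apply/orP; left; apply/eqP; field; rewrite gt_eqF.
  by rewrite ler_norml => /andP[+ _]; rewrite mulrBl; lra.
have main2 : w * (L - x) + kappa * (x' <= L - delta)%R%:R <= derive1 U x * (L - x).
  have [x'L|_] := leP x' (L - delta).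
    have xL : x <= L - delta / 2 by lra.
    have dle : derive1 U (L - delta / 2) <= derive1 U x.
      move: xL; rewrite le_eqVlt => /predU1P[->//|].
      by move/(utility_derive_lt U_utility U_assumption1 x0)/ltW.
    have wd : w < derive1 U (L - delta / 2) by apply: utility_derive_lt => //; lra.
    rewrite mulr1 /kappa.
    have : (derive1 U (L - delta / 2) - w) * (delta / 2) <=
       (derive1 U x - w) * (L - x).
      apply: ler_pM.
      - by rewrite subr_ge0 ltW.
      - by rewrite divr_ge0// ltW.
      - by rewrite lerD2r.
      - by lra.
    by rewrite mulrBl; lra.
  rewrite mulr0 addr0; have [xL|xL|->] := ltgtP x L; last by rewrite subrr !mulr0.
    have := utility_derive_lt U_utility U_assumption1 x0 xL; rewrite -/w; nra.
  have := utility_derive_lt U_utility U_assumption1 L0 xL; rewrite -/w; nra.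
have main3 : w * x <= w * x' + eps / 2.
  by apply: le_trans (_ : w * (x' + e1) <= _); [rewrite ler_pM2l|rewrite mulrDr lerD2l].
have -> : L * (k.+1%:R * ci) / x = k.+1%:R * ci * (L / x - 1) + k.+1%:R * ci.
  by field; rewrite gt_eqF.
rewrite dx in main1; rewrite -/ci; lra.
Qed.

End pointwise.

(** * The system problem *)

(** At [y = 0] the value is an infimum, possibly [-oo], and the bound is reached through small
    positive points. *)
Lemma utility0_tangent (R : realType) (U : R -> R) (x y : R) : utility U ->
  0 < x -> 0 <= y -> (utility0 U y <= (U x + derive1 U x * (y - x))%:E)%E.
Proof.
move=> Uu x0; rewrite le_eqVlt => /predU1P[<-|y0]; last first.
  by rewrite /utility0 y0 lee_fin utility_tangent.
rewrite /utility0 ltxx.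
have [Uincr _ _ _] := Uu.
have /cvg_lim -> // : (U y)%:E @[y --> 0^'+] -->
    ereal_inf [set (U y)%:E | y in [set` Interval (BRight 0) +oo%O]].
  apply: nondecreasing_at_right_cvge => // u v.
  rewrite !in_itv /= !andbT => u0 v0; rewrite le_eqVlt => /predU1P[->//|uv].
  by rewrite lee_fin ltW// Uincr.
apply/lee_addgt0Pr => e e0.
have w0 := utility_derive_gt0 Uu x0.
have ew : 0 < e / derive1 U x by rewrite divr_gt0.
(* At [e / derive1 U x] the tangent line is exactly [e] above its value at 0. *)
apply: (@le_trans _ _ (U (e / derive1 U x))%:E).
  by apply: ereal_inf_lbound; exists (e / derive1 U x) => //=; rewrite in_itv/= ew.
rewrite -EFinD lee_fin; apply: le_trans (utility_tangent Uu x0 ew) _.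
by rewrite !mulrBr mulrCA divff ?gt_eqF// mulr0 mulr1; lra.
Qed.

Lemma is_derive_sum_seq (R : realType) (T : Type) (r : seq T) (f : T -> R -> R)
    (df : T -> R) (x : R) :
  (forall t, is_derive x 1 (f t) (df t)) ->
  is_derive x 1 (fun y => \sum_(t <- r) f t y) (\sum_(t <- r) df t).
Proof.
move=> fdf; elim: r => [|t r IHr].
  rewrite big_nil (_ : (fun y => _) = cst 0); first exact: is_derive_cst.
  by apply/funext => y; rewrite big_nil.
rewrite big_cons (_ : (fun y => _) = f t + (fun y => \sum_(t <- r) f t y)).
  exact: is_deriveD.
by apply/funext => y; rewrite big_cons.
Qed.

Lemma is_derive_line (R : realType) (U : R -> R) (x h : R) :
  derivable U x 1 -> is_derive (0 : R) 1 (fun t : R => U (x + h * t)) (derive1 U x * h).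
Proof.
move=> dU; have dl : is_derive (0 : R) 1 (fun t => x + h * t) h.
  have dc : is_derive (0 : R) 1 (cst x : R -> R) 0 by exact: is_derive_cst.
  have di : is_derive (0 : R) 1 (id : R -> R) 1 by exact: is_derive_id.
  have := is_deriveD dc (is_deriveZ h di).
  by rewrite add0r [h *: 1]mulr1.
apply: (@is_derive1_comp _ U (fun t => x + h * t)).
by rewrite mulr0 addr0; apply: DeriveDef => //; rewrite derive1E.
Qed.

Section optimum.
Context (R : realType) (J I : finType) (N : network R J I).
Variables (U : I -> R -> R) (Lstar : I -> R).
Hypothesis U_utility : forall i, utility (U i).
Hypothesis Lstar_optimal : system_optimal N U Lstar.

Let line (L : I -> R) (t : R) i := Lstar i + t * (L i - Lstar i).

Lemma line_feasible (L : I -> R) t : feasible N L -> 0 <= t <= 1 ->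
  feasible N (line L t).
Proof.
move=> [L0 Lc] /andP[t0 t1]; have [[S0 Sc] _] := Lstar_optimal.
have lE i : line L t i = (1 - t) * Lstar i + t * L i by rewrite /line; ring.
have t1' : 0 <= 1 - t by lra.
split=> [i|j]; first by rewrite lE addr_ge0// mulr_ge0.
under eq_bigr do rewrite lE; rewrite big_split /= -!mulr_sumr.
rewrite [leRHS](_ : _ = (1 - t) * cap N j + t * cap N j); last by ring.
by rewrite lerD// ler_wpM2l.
Qed.

Lemma sum_utility0 (L : I -> R) : (forall i, 0 < L i) ->
  (\sum_i utility0 (U i) (L i) = (\sum_i U i (L i))%:E)%E.
Proof. by move=> L0; rewrite -sumEFin; apply: eq_bigr => i _; rewrite /utility0 L0. Qed.

(* Comparing the optimum with [line L t] through the tangent of the utilities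
   at [line L t] avoids evaluating them at [Lstar], where they may be [-oo]. *)
Lemma optimal_variation (L : I -> R) t : feasible N L -> 0 < t <= 1 ->
  (forall i, 0 < line L t i) ->
  \sum_i derive1 (U i) (line L t i) * (L i - Lstar i) <= 0.
Proof.
move=> Lf /andP[t0 t1] lt0; have [[S0 _] opt] := Lstar_optimal.
have lf : feasible N (line L t) by apply: line_feasible; rewrite ?(ltW t0).
have := opt _ lf; rewrite sum_utility0// => /le_trans.
move=> /(_ (\sum_i (U i (line L t i) +
    derive1 (U i) (line L t i) * (Lstar i - line L t i))%:E)%E) H.
have {}/H : (\sum_i utility0 (U i) (Lstar i) <= \sum_i (U i (line L t i) +
    derive1 (U i) (line L t i) * (Lstar i - line L t i))%:E)%E.
  by apply: lee_sum => i _; exact: utility0_tangent.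
rewrite sumEFin lee_fin big_split /= lerDl.
rewrite (eq_bigr (fun i => (- t) * (derive1 (U i) (line L t i) * (L i - Lstar i)))).
  by rewrite -mulr_sumr mulNr oppr_ge0 pmulr_rle0.
by move=> i _; rewrite /line; ring.
Qed.

Lemma feasible_interior : exists2 e : R, 0 < e & feasible N (fun=> e).
Proof.
(* [S^-1] lies below every capacity, and the summand 1 keeps [S] positive even for an empty sum. *)
pose S : R := \sum_j (cap N j)^-1 + 1.
have C0 j : 0 < (cap N j)^-1 by rewrite invr_gt0 cap_gt0.
have S0 : 0 < S by rewrite ltr_wpDl// sumr_ge0// => j _; rewrite ltW.
pose n : R := #|I|%:R + 1.
have n0 : 0 < n by rewrite ltr_wpDl.
exists (S^-1 / n) => [|]; first by rewrite divr_gt0// invr_gt0.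
split=> [i|j]; first by rewrite ltW// divr_gt0// invr_gt0.
apply: (@le_trans _ _ (\sum_(i : I) S^-1 / n)).
  rewrite big_mkcond; apply: ler_sum => i _; case: ifP => // _.
  by rewrite ltW// divr_gt0// invr_gt0.
rewrite sumr_const -mulr_natl mulrCA.
apply: (@le_trans _ _ S^-1).
  by rewrite ler_piMr ?invr_ge0 ?(ltW S0)// ler_pdivrMr// mul1r lerDl.
rewrite -[leRHS]invrK lef_pV2 ?posrE//.
rewrite /S (bigD1 j)//= -addrA lerDl addr_ge0// sumr_ge0// => j' _.
by rewrite ltW.
Qed.

(** If [Lstar i] were 0, moving slightly towards the constant vector [e] would gain at an unbounded
    marginal rate on route [i], while the other routes lose at rate at most [C]. *)
Lemma optimal_gt0 (U_assumption1 : forall i, assumption1 (U i)) i :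
  0 < Lstar i.
Proof.
have [[S0 Sc] _] := Lstar_optimal.
rewrite lt_neqAle S0 andbT; apply/eqP => Si.
have [e e0 ef] := feasible_interior.
pose C := \sum_k derive1 (U k) e * Lstar k.
have [_ _ _ Uoo] := U_utility i.
have /filter_ex[x [xC [x0 xe]]] : \forall x \near 0^'+,
    C / e < derive1 (U i) x /\ (0 < x /\ x < e).
  near=> x; split.
    by near: x; move/cvgryPgt : Uoo; exact.
  by split; near: x; [exact: nbhs_right_gt|exact: nbhs_right_lt].
pose t := x / e; have t0 : 0 < t by rewrite divr_gt0.
have t1 : t <= 1 by rewrite ler_pdivrMr// mul1r ltW.
have lE k : line (fun=> e) t k = (1 - t) * Lstar k + t * e by rewrite /line; ring.
have l0 k : 0 < line (fun=> e) t k.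
  by rewrite lE ltr_wpDl//; [rewrite mulr_ge0// subr_ge0|rewrite mulr_gt0].
have := optimal_variation ef _ l0; rewrite t0 t1 => /(_ isT).
rewrite (bigD1 i)//= {1}/line -Si add0r subr0 divfK ?gt_eqF//.
rewrite ltr_pdivrMr// in xC.
suff : - C <= \sum_(k | k != i) derive1 (U k) (line (fun=> e) t k) * (e - Lstar k) by lra.
rewrite /C (bigD1 i)//= -Si mulr0 add0r -sumrN; apply: ler_sum => k _.
have we0 := utility_derive_gt0 (U_utility k) e0.
have wl0 := utility_derive_gt0 (U_utility k) (l0 k).
have [ek|ke] := leP e (Lstar k); last first.
  apply: (@le_trans _ _ 0); first by rewrite oppr_le0 mulr_ge0// ltW.
  by rewrite mulr_ge0 ?ltW// subr_gt0.
have el : e <= line (fun=> e) t k by rewrite lE; nra.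
have : derive1 (U k) (line (fun=> e) t k) <= derive1 (U k) e.
  move: el; rewrite le_eqVlt => /predU1P[<-//|].
  by move/(utility_derive_lt (U_utility k) (U_assumption1 k) e0)/ltW.
by nra.
Unshelve. all: by end_near. Qed.

(** Positivity of [Lstar] makes the total utility real and differentiable along the segment, so its
    difference quotients decide; passing to the limit in [optimal_variation] would call for
    continuity of the derivatives. *)
Lemma optimal_first_order (L : I -> R) : (forall i, 0 < Lstar i) ->
  feasible N L -> \sum_i derive1 (U i) (Lstar i) * (L i - Lstar i) <= 0.
Proof.
move=> S0 Lf; have [L0 _] := Lf; have [_ opt] := Lstar_optimal.
pose F (t : R) := \sum_i U i (Lstar i + (L i - Lstar i) * t).
set D := \sum_i _; rewrite leNgt; apply/negP => D0.
have dF : is_derive (0 : R) 1 F D.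
  apply: is_derive_sum_seq => i; apply: is_derive_line.
  by case: (U_utility i) => _ _ dU _; apply: dU.
have D1 : derive1 F 0 = D by rewrite derive1E; case: dF.
have /derivable_cvg_quotient : derivable F (0 : R) 1 by case: dF.
rewrite D1 => /cvgrPdist_lt/(_ _ D0).
rewrite near_withinE => /nbhs_ballP[r /= r0 rP].
pose t := Num.min 2^-1 (r / 2).
have t0 : 0 < t by rewrite lt_min invr_gt0 ltr0n divr_gt0.
have t1 : t < 1 by rewrite gt_min invf_lt1 ?ltr1n.
have tr : t < r by rewrite gt_min; apply/orP; right; lra.
have := rP t; rewrite /ball /= sub0r normrN gtr0_norm// => /(_ tr).
rewrite gt_eqF// => /(_ isT); apply/negP; rewrite -leNgt addr0.
have lE i : line L t i = (1 - t) * Lstar i + t * L i by rewrite /line; ring.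
have l0 i : 0 < line L t i.
  by rewrite lE ltr_pwDl ?mulr_ge0 ?(ltW t0)// mulr_gt0// subr_gt0.
have lf : feasible N (line L t) by apply: line_feasible; rewrite ?(ltW t0) ?(ltW t1).
have := opt _ lf; rewrite !sum_utility0// lee_fin => Fle.
have FtE : F t = \sum_i U i (line L t i).
  by apply: eq_bigr => i _; rewrite /line mulrC.
have F0E : F 0 = \sum_i U i (Lstar i).
  by apply: eq_bigr => i _; rewrite mulr0 addr0.
apply: le_trans (ler_norm _); rewrite lerDl oppr_ge0 FtE F0E.
by rewrite pmulr_rle0 ?invr_gt0// subr_le0.
Qed.

End optimum.

(** * Convergence of throughputs *)

Section limit.
Context (R : realType) (J I : finType) (N : network R J I).
Variables (U : I -> R -> R) (d : I -> nat -> R).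
Variables (p : nat -> state N -> R) (Lstar : I -> R).
Hypothesis U_utility : forall i, utility (U i).
Hypothesis U_assumption1 : forall i, assumption1 (U i).
Hypothesis U_assumption2 : forall i, assumption2 (U i).
Hypothesis d_bounded :
  forall i, exists B : R, forall c, (0 < c)%N -> `|d i c| <= B.
Hypothesis G_defined : forall i, Gc_well_defined (U i) (d i).
Hypothesis p_stationary : forall c, (0 < c)%N ->
  stationary (fun s s' : state N =>
    rate N (fun i => gc (U i) (d i) c) (val s) (val s')) (p c).
Hypothesis Lstar_optimal : system_optimal N U Lstar.

Let g c i := gc (U i) (d i) c.
Let P c := extend0 (p c).

Lemma gc_gt0 c i k : 0 < g c i k.
Proof. exact: expR_gt0. Qed.

Lemma d_ge0 i c : (0 < c)%N -> 0 <= d i c.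
Proof.
move=> c0; have [] := G_defined i 0 c0.
by rewrite /scaled_arg mul0r add0r pmulr_lge0// invr_gt0 ltr0n.
Qed.

(** Uniform in [c] and [k] because [d] is bounded, and nonnegative by well-definedness at
    [k = 0]. *)
Lemma window_demand i : exists2 D : R, 0 <= D & forall c k, (0 < c)%N ->
  k%:R / c%:R <= demand (U i) (g c i k) <= (k.+1%:R + D) / c%:R.
Proof.
have [B dB] := d_bounded i; exists `|B| => // c k c0.
have cR : (0 : R) <= c%:R^-1 by rewrite invr_ge0.
have /andP[] := gc_demand (U_utility i) (U_assumption1 i) (U_assumption2 i) k c0 (G_defined i).
rewrite -/(g c i k) /scaled_arg -!mulrDl => lo hi; apply/andP; split.
  by apply: le_trans lo; rewrite ler_wpM2r// lerDl d_ge0.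
apply: le_trans hi _; rewrite ler_wpM2r// lerD2l.
by rewrite (le_trans (ler_norm _))// (le_trans (dB _ c0))// ler_norm.
Qed.

Lemma gc_bounded c : (0 < c)%N -> exists K, forall i k, g c i k <= K.
Proof.
move=> c0; have cR : (0 : R) < c%:R by rewrite ltr0n.
suff /choice[K gK] : forall i, exists K, forall k, g c i k <= K.
  exists (\sum_i `|K i|) => i k; rewrite (bigD1 i)//= (le_trans (gK i k))//.
  by rewrite (le_trans (ler_norm _))// lerDl sumr_ge0.
move=> i; have ci0 : (0 : R) < c%:R^-1 by rewrite invr_gt0.
have [y y0 yE] := demand_surj (U_utility i) (U_assumption1 i) (U_assumption2 i) ci0.
(* For [k = 0] the lower bound on the demand is 0 and gives no bound on the rate, hence the separate
   summand. *)
exists (g c i 0 + y) => k; have g0 := gc_gt0 c i.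
case: k => [|k]; first by rewrite lerDl ltW.
have [D D0 gD] := window_demand i.
have /andP[lo _] := gD c k.+1 c0.
apply: (@le_trans _ _ y); last by rewrite lerDr ltW.
rewrite -(demand_le (U_utility i) (U_assumption1 i))// yE.
by apply: le_trans lo; rewrite ler_peMl ?(ltW ci0)// ler1n.
Qed.

Section congestion_level.
Variable c : nat.
Hypothesis c0 : (0 < c)%N.

Lemma P_ge0 s : 0 <= P c s.
Proof. exact: stationary_ge0 (p_stationary c0) s. Qed.

Lemma P_law : insertion_law N (g c) (P c).
Proof.
exact (stationary_insertion_law (gc_gt0 c) (p_stationary c0) (gc_bounded c0)).
Qed.

Lemma P_valid s : ~~ valid N s -> P c s = 0.
Proof. exact: extend0_invalid. Qed.

Lemma P_sum1 : (\esum_(s in [set: config J I]) (P c s)%:E = 1)%E.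
Proof. exact: stationary_sum1 (p_stationary c0). Qed.

Lemma throughput_flow i : throughput (g c) (p c) i = flow N (g c) (P c) i.
Proof.
rewrite /flow -(@esum_state _ _ _ N) => [|s sv]; last by rewrite P_valid// mul0r.
by apply: eq_esum => s _; rewrite /P extend0_val.
Qed.

End congestion_level.

Let Lam c i := fine (flow N (g c) (P c) i).

Lemma Lam_feasible c : (0 < c)%N -> feasible N (Lam c).
Proof.
move=> c0; apply: (flow_feasible_real (gc_gt0 c) (P_ge0 c0) (P_law c0) (P_sum1 c0)) => i //.
by apply/fine_ge0/flow_ge0; [exact: gc_gt0|exact: P_ge0].
Qed.

(** Supplies [tight]. Once [k] reaches [(1 + dm i) * c] the rate at [k.-1] is at most [Lstar i / 2],
    and the ratio alone gives [2 * k]; smaller windows are paid for by [K * c]. The 1 in [1 + dm i]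
    absorbs the shift to [k.-1]. *)
Lemma window_backlog : exists2 K : R, 0 <= K & forall c i k, (0 < c)%N ->
  2 * k%:R <= Lstar i * k%:R / g c i k.-1 + K * c%:R.
Proof.
have S0 := optimal_gt0 U_utility Lstar_optimal U_assumption1.
have S20 i : 0 < Lstar i / 2 by rewrite divr_gt0.
pose dm i := demand (U i) (Lstar i / 2).
have dm0 i : 0 < dm i by exact: demand_gt0.
pose K := \sum_i (2 * (1 + dm i)).
have dK i : 2 * (1 + dm i) <= K.
  rewrite /K (bigD1 i)//= lerDl sumr_ge0// => i' _.
  by rewrite mulr_ge0// addr_ge0// ltW.
have K0 : 0 <= K by apply: sumr_ge0 => i _; rewrite mulr_ge0// addr_ge0// ltW.
exists K => // c i k c0; have cR : (0 : R) < c%:R by rewrite ltr0n.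
have g0 := gc_gt0 c i k.-1.
have q0 : 0 <= Lstar i * k%:R / g c i k.-1 by rewrite !mulr_ge0 ?invr_ge0// ltW.
have [kc|kc] := leP ((1 + dm i) * c%:R) k%:R; last first.
  have := dK i; rewrite -(ler_pM2r cR); nra.
have c1 : (1 : R) <= c%:R by rewrite ler1n.
have k1 : (1 : R) <= k%:R by apply: le_trans kc; have := dm0 i; nra.
case: k => [|k] in g0 q0 kc k1 *; first by rewrite ler10 in k1.
have [D D0 /(_ c k c0)/andP[lo _]] := window_demand i.
have gL : g c i k <= Lstar i / 2.
  rewrite -(demand_le (U_utility i) (U_assumption1 i))//.
  apply: le_trans lo; rewrite ler_pdivlMr//.
  by move: kc; rewrite -addn1 natrD -/(dm i); lra.
apply: (@le_trans _ _ (Lstar i * k.+1%:R / g c i k)); last first.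
  by rewrite lerDl mulr_ge0// ltW.
rewrite ler_pdivlMr// mulrAC; apply: ler_wpM2r => //; lra.
Qed.

Lemma Lam_lower i eta : 0 < eta -> exists c1 : R, forall c, (0 < c)%N ->
  c1 <= c%:R -> Lstar i - eta <= Lam c i.
Proof.
move=> eta0.
have S0 := optimal_gt0 U_utility Lstar_optimal U_assumption1.
have [Sf _] := Lstar_optimal.
pose delta k := Num.min (eta / 2) (Lstar k / 2).
have delta_gt0 k : 0 < delta k by rewrite lt_min !divr_gt0.
have delta_lt k : delta k < Lstar k.
  by rewrite gt_min; apply/orP; right; have := S0 k; lra.
pose w k := derive1 (U k) (Lstar k).
have w0 k : 0 < w k by exact: utility_derive_gt0.
pose kappa k := (derive1 (U k) (Lstar k - delta k / 2) - w k) * (delta k / 2).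
have kappa0 k : 0 < kappa k.
  rewrite mulr_gt0 ?divr_gt0// subr_gt0.
  by apply: utility_derive_lt => //; have := delta_lt k; have := delta_gt0 k; lra.
pose W := \sum_k w k * Lstar k.
have W0 : 0 <= W by apply: sumr_ge0 => k _; rewrite mulr_ge0 ?ltW.
(* The final loss beyond [delta i <= eta / 2] is at most [theta * Q]: [Lstar i] comes from the
   truncated mass, [2 + W] from the three error terms of [underuse_bound]. *)
pose Q := Lstar i + Lstar i / kappa i * (2 + W).
have Lk0 : 0 < Lstar i / kappa i by rewrite divr_gt0.
have Q0 : 0 < Q by rewrite addr_gt0// mulr_gt0// ltr_pwDl.
pose theta := eta / 2 / Q.
have theta0 : 0 < theta by rewrite !divr_gt0.
pose eps := theta / (#|I|%:R + 1).
have I0 : (0 : R) < #|I|%:R + 1 by rewrite ltr_wpDl.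
have eps0 : 0 < eps by rewrite divr_gt0.
have Ieps : #|I|%:R * eps <= theta.
  by rewrite /eps mulrCA ler_piMr ?(ltW theta0)// ler_pdivrMr// mul1r lerDl.
have [K K0 tightK] := window_backlog.
(* By [tight], the population then exceeds [B * c] with probability at most [theta], for every
   [c]. *)
pose B := (Num.Def.archi_bound ((#|J|%:R + #|I|%:R * K) / theta)).+1.
have JK0 : 0 <= #|J|%:R + #|I|%:R * K by rewrite addr_ge0// mulr_ge0.
have BE : (#|J|%:R + #|I|%:R * K) / B%:R <= theta.
  rewrite ler_pdivrMr ?ltr0n// [leRHS]mulrC -ler_pdivrMr//.
  apply: le_trans (ltW (archi_boundP (divr_ge0 JK0 (ltW theta0)))) _.
  by rewrite ler_nat.
have BR0 : (0 : R) < B%:R by rewrite ltr0n.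
have /choice[c0 c0P] : forall k, exists c0 : R, 0 < c0 /\
    forall c, (0 < c)%N -> c0 <= c%:R -> forall n, n%:R / c%:R <= (B%:R : R) ->
    n%:R / c%:R + w k * Lstar k + kappa k * (g c k n <= Lstar k - delta k)%R%:R <=
    Lstar k * (n%:R / c%:R) / g c k n.-1 +
      w k * Num.min (g c k n) (2 * Lstar k) + eps.
  move=> k; have [D D0 gD] := window_demand k.
  have dk : 0 < delta k < Lstar k by rewrite delta_gt0 delta_lt.
  have [c0 c00 H] := window_pointwise (U_utility k) (U_assumption1 k)
    (U_assumption2 k) D0 dk BR0 eps0.
  exists c0; split => // c cp cc n nB; apply: H cc _ _ _ nB => [n'|n'].
    exact: gc_gt0.
  exact: gD.
exists (\sum_k `|c0 k| + #|J|%:R / theta) => c cp cc.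
have cR : (0 : R) < c%:R by rewrite ltr0n.
have c0c k : c0 k <= c%:R.
  apply: le_trans (le_trans (ler_norm _) _) cc; rewrite (bigD1 k)//= -addrA lerDl.
  by rewrite addr_ge0 ?sumr_ge0// divr_ge0// ltW.
have Jc : #|J|%:R / c%:R <= theta.
  rewrite ler_pdivrMr// [leRHS]mulrC -ler_pdivrMr//; apply: le_trans cc.
  by rewrite lerDr sumr_ge0.
pose n := (B * c)%N.
have gg := gc_gt0 c.
have Pg := P_ge0 cp; have Pl := P_law cp; have Pv := @P_valid c; have Ps := P_sum1 cp.
pose X := mean (P c) (trunc R n).
have X1 : 1 - X <= theta.
  have n0 : (0 < n)%N by rewrite muln_gt0.
  have Kc0 : 0 <= K * c%:R by rewrite mulr_ge0.
  have := tight gg Pg Pl Pv Ps Sf Kc0 n0 (fun i k => tightK c i k cp).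
  move=> /le_trans; apply; apply: le_trans BE.
  rewrite /n natrM ler_pdivrMr ?mulr_gt0//.
  have -> : (#|J|%:R + #|I|%:R * K) / B%:R * (B%:R * c%:R) =
      #|J|%:R * c%:R + #|I|%:R * (K * c%:R) by field; rewrite gt_eqF.
  by rewrite lerD2r ler_peMr// ler1n.
pose z k m := Num.min (g c k m) (2 * Lstar k).
have zZ k m : 0 <= z k m <= 2 * Lstar k.
  rewrite le_min ge_min lexx orbT andbT (ltW (gg k m))/=.
  by rewrite mulr_ge0// ltW.
have zg k m : z k m <= g c k m by rewrite ge_min lexx.
have fo := optimal_first_order U_utility Lstar_optimal S0.
have := underuse_bound (n := n) gg Pg Pl Pv Ps cR (ltW eps0) Sf
  (fun k => ltW (w0 k)) (fun k => ltW (kappa0 k)) zZ zg fo.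
rewrite -/W -/X => /(_ delta) ub.
have {}ub : \sum_k kappa k * mean (P c)
      (fun s => trunc R n s * (g c k (window N s k) <= Lstar k - delta k)%R%:R) <=
    #|J|%:R / c%:R + #|I|%:R * eps + (1 - X) * W.
  apply: ub => k m mn; rewrite -(ler_pM2r (_ : 0 < c%:R^-1)) ?invr_gt0//.
  have mB : m%:R / c%:R <= B%:R :> R by rewrite ler_pdivrMr// -natrM ler_nat.
  have := (c0P k).2 c cp (c0c k) m mB.
  set b := (_ <= _)%R%:R; rewrite -/(z k m) => H.
  apply: (le_trans _ (le_trans H _)).
    by rewrite le_eqVlt; apply/orP; left; apply/eqP; field; rewrite gt_eqF.
  by rewrite le_eqVlt; apply/orP; left; apply/eqP; field; rewrite !gt_eqF// gg.
have bb k : 0 <= mean (P c) (fun s => trunc R n s *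
    (g c k (window N s k) <= Lstar k - delta k)%R%:R).
  apply: mean_ge0 => //; apply: nnboundedM; exact: nnbounded_bool.
rewrite (bigD1 i)//= in ub.
have SB0 : 0 <= \sum_(k | k != i) kappa k * mean (P c) (fun s => trunc R n s *
    (g c k (window N s k) <= Lstar k - delta k)%R%:R).
  by apply: sumr_ge0 => k _; rewrite mulr_ge0// ltW.
have dL : 0 <= delta i <= Lstar i by rewrite !ltW.
have := flow_ge_of_underuse gg Pg Pl Ps n i dL.
rewrite -/X -/(Lam c i); set b := mean _ _ in ub *.
move=> lowX.
have bi : Lstar i * b <= Lstar i / kappa i * (theta * (2 + W)).
  rewrite mulrAC -mulrA; apply: ler_wpM2l; first exact: ltW.
  rewrite ler_pdivlMr// mulrC.
  have : (1 - X) * W <= theta * W by rewrite ler_wpM2r.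
  by lra.
have d_eta : delta i <= eta / 2 by rewrite ge_min lexx.
have thQ : theta * Q = eta / 2 by rewrite /theta divfK ?gt_eqF.
have X0 : (Lstar i - delta i) * (1 - X) <= Lstar i * theta.
  apply: (@le_trans _ _ ((Lstar i - delta i) * theta)).
    by apply: ler_wpM2l => //; rewrite subr_ge0; case/andP: dL.
  by apply: ler_wpM2r; rewrite ?(ltW theta0)// gerBl; case/andP: dL.
have QE : theta * Q = Lstar i * theta + Lstar i / kappa i * (theta * (2 + W)).
  by rewrite /Q; ring.
by lra.
Qed.

Lemma Lam_cvg i (eta : R) : 0 < eta -> exists c1 : R, forall c, (0 < c)%N ->
  c1 <= c%:R -> `|Lstar i - Lam c i| <= eta.
Proof.
move=> eta0.
have S0 := optimal_gt0 U_utility Lstar_optimal U_assumption1.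
pose w k := derive1 (U k) (Lstar k).
have w0 k : 0 < w k by exact: utility_derive_gt0.
pose S := \sum_k w k.
have wS : w i <= S by rewrite /S (bigD1 i)//= lerDl sumr_ge0// => k _; exact: ltW.
have S_gt0 : 0 < S by exact: lt_le_trans wS.
(* By the first-order condition, shortfalls of at most [e] on the other routes allow an excess of at
   most [e * S / w i = eta] on route [i]. *)
pose e := eta * (w i / S); have e0 : 0 < e by rewrite mulr_gt0// divr_gt0.
have e_eta : e <= eta.
  by rewrite /e ler_piMr ?(ltW eta0)// ler_pdivrMr// mul1r.
have /choice[c1 c1P] := fun k => Lam_lower k e0.
exists (\sum_k `|c1 k|) => c cp cc.
have low k : Lstar k - e <= Lam c k.
  apply: c1P => //; apply: le_trans (le_trans (ler_norm _) _) cc.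
  by rewrite (bigD1 k)//= lerDl sumr_ge0.
have fo := optimal_first_order U_utility Lstar_optimal S0 (Lam_feasible cp).
rewrite (bigD1 i)//= -/(w i) in fo.
have rest : - (e * S) <= \sum_(k | k != i) derive1 (U k) (Lstar k) * (Lam c k - Lstar k).
  apply: (@le_trans _ _ (\sum_(k | k != i) - (e * w k))).
    rewrite sumrN lerN2 -mulr_sumr ler_wpM2l ?(ltW e0)// /S [leRHS](bigD1 i)//=.
    by rewrite lerDr ltW.
  apply: ler_sum => k _; rewrite -/(w k) mulrC -mulrN ler_pM2l//.
  by have := low k; lra.
have eS : e * S = eta * w i by rewrite /e; field; rewrite gt_eqF.
have up : w i * (Lam c i - Lstar i) <= w i * eta by rewrite [leRHS]mulrC; lra.
rewrite ler_pM2l// in up; have := low i.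
by rewrite distrC ler_norml up andbT; lra.
Qed.

Lemma throughput_cvg i :
  throughput (fun i => gc (U i) (d i) c) (p c) i @[c --> \oo] --> (Lstar i)%:E.
Proof.
have E : \forall c \near \oo,
    (Lam c i)%:E = throughput (fun i => gc (U i) (d i) c) (p c) i.
  exists 1%N => // c /= c0; rewrite throughput_flow// /Lam fineK//.
  apply: flow_fin; [exact: gc_gt0|exact: P_ge0|exact: P_law|exact: P_sum1].
apply: cvg_trans (near_eq_cvg E) _.
apply: cvg_EFin; first by exact: nearW.
apply/cvgrPdist_le => e e0; have [c1 c1P] := Lam_cvg i e0.
near=> c; apply: c1P; near: c; first exact: nbhs_infty_gt.
exact: nbhs_infty_ger.
Unshelve. all: by end_near. Qed.

End limit.

Theorem theorem5p5 (R : realType) (J I : finType) (N : network R J I)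
  (U : I -> R -> R) (d : I -> nat -> R)
  (p : nat -> state N -> R) (Lstar : I -> R)
  (U_utility : forall i, utility (U i))
  (U_assumption1 : forall i, assumption1 (U i))
  (U_assumption2 : forall i, assumption2 (U i))
  (d_bounded : forall i, exists B : R, forall c, (0 < c)%N -> `|d i c| <= B)
  (G_defined : forall i, Gc_well_defined (U i) (d i))
  (p_stationary : forall c, (0 < c)%N ->
     stationary (fun s s' : state N =>
       rate N (fun i => gc (U i) (d i) c) (val s) (val s')) (p c))
  (Lstar_optimal : system_optimal N U Lstar) :
  forall i : I,
    throughput (fun i => gc (U i) (d i) c) (p c) i @[c --> \oo]
      --> (Lstar i)%:E.
Proof. by move=> i; apply: throughput_cvg. Qed.
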